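(* Let $R$ be a complete discrete valuation ring in which $2$ is invertible, with fraction field $F$. Let $E/F$ be a finite extension of odd degree and let $S$ be the integral closure of $R$ in $E$. Then for any quadratic lattices $M$ and $N$ over $R$, $N$ can be embedded into $M$ over $R$ if and only if $S\otimes_R N$ can be embedded into $S\otimes_R M$ over $S$.
   Context: The field $F$ has characteristic $\neq 2$. A quadratic lattice over $R$ is a finitely generated torsion-free $R$-module $M$ together with a non-degenerate quadratic form $Q$ on the $F$-vector space $F\otimes_R M$. An embedding of $(N,q)$ into $(M,Q)$ over $R$ is an $R$-module homomorphism $\sigma:N\to M$ with $q=Q\circ\sigma$ (automatically injective). $S\otimes_R M$, with the form on $E\otimes_F(F\otimes_R M)$ obtained by extending scalars, is a quadratic lattice over $S$. *)

(* Defs.v *)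
From HB Require Import structures.
From mathcomp Require Import all_boot all_algebra all_field.
From mathcomp Require Import ring boolp.

Set Implicit Arguments.
Unset Strict Implicit.
Unset Printing Implicit Defensive.
Import GRing.Theory.
Local Open Scope ring_scope.
Local Open Scope quotient_scope.

Section DVR.
Variable R : idomainType.
Implicit Types (I P : {pred R}) (t a x : R).

Definition generates a I : Prop := forall x, x \in I <-> exists c, x = c * a.

(* In MathComp, [idealr_closed] means "proper ideal"; the unit ideal is
   principal anyway. *)
Definition principal_ideal_domain : Prop :=
  forall I, idealr_closed I -> exists a, generates a I.

Definition nonzero_prime_ideal P : Prop :=
  [/\ idealr_closed P, prime_idealr_closed P & exists2 x, x \in P & x != 0].

Definition discrete_valuation_ring : Prop :=
  principal_ideal_domain /\
  exists P, nonzero_prime_ideal P /\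
    forall P', nonzero_prime_ideal P' -> P' =i P.

Definition uniformizer t : Prop :=
  exists2 P, nonzero_prime_ideal P & generates t P.

(* [x] and [y] agree modulo the [n]-th power [(t ^+ n)] of the ideal [(t)]. *)
Definition adic_close t (n : nat) x y : Prop := exists c, x - y = c * t ^+ n.

Definition adic_cauchy t (u : nat -> R) : Prop :=
  forall n, exists k, forall i j,
    (k <= i)%N -> (k <= j)%N -> adic_close t n (u i) (u j).

Definition adic_limit t (u : nat -> R) (l : R) : Prop :=
  forall n, exists k, forall i, (k <= i)%N -> adic_close t n (u i) l.

Definition complete_dvr : Prop :=
  discrete_valuation_ring /\
  forall t, uniformizer t ->
    forall u, adic_cauchy t u -> exists l, adic_limit t u l.

End DVR.

Section Tensor.
Variables (A B : comNzRingType) (f : {rmorphism A -> B}) (M : lmodType A).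

(* [tensor f M] is [B ⊗_A M], with [B] an [A]-algebra through [f].
   A list [:: (b1, m1); (b2, m2); ...] stands for the formal sum of the
   [bi ⊗ mi].  Concatenation of lists becomes the addition of [B ⊗_A M]. *)
Inductive tensor_eq : seq (B * M) -> seq (B * M) -> Prop :=
| TensorRefl s : tensor_eq s s
| TensorSym s t : tensor_eq s t -> tensor_eq t s
| TensorTrans s t u : tensor_eq s t -> tensor_eq t u -> tensor_eq s u
| TensorCat s s' t t' :
    tensor_eq s s' -> tensor_eq t t' -> tensor_eq (s ++ t) (s' ++ t')
| TensorC s t : tensor_eq (s ++ t) (t ++ s)
| Tensor0 m : tensor_eq [:: (0, m)] [::]
| TensorDl b b' m : tensor_eq [:: (b + b', m)] [:: (b, m); (b', m)]
| TensorDr b m m' : tensor_eq [:: (b, m + m')] [:: (b, m); (b, m')]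
| TensorA b a m : tensor_eq [:: (b * f a, m)] [:: (b, a *: m)].

Definition tensor_rel : rel (seq (B * M)) := fun s t => `[< tensor_eq s t >].

Lemma tensor_rel_refl : reflexive tensor_rel.
Proof. by move=> s; apply/asboolP; exact: TensorRefl. Qed.

Lemma tensor_rel_sym : symmetric tensor_rel.
Proof. by move=> s t; apply/asboolP/asboolP => /TensorSym. Qed.

Lemma tensor_rel_trans : transitive tensor_rel.
Proof.
move=> t s u /asboolP st /asboolP tu; apply/asboolP; exact: TensorTrans tu.
Qed.

Canonical tensor_equiv :=
  EquivRel tensor_rel tensor_rel_refl tensor_rel_sym tensor_rel_trans.

Definition tensor := {eq_quot tensor_rel}.

HB.instance Definition _ := Choice.on tensor.
HB.instance Definition _ := EqQuotient.on tensor.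

Definition tsum (s : seq (B * M)) : tensor := \pi_tensor s.

Definition tpure (b : B) (m : M) : tensor := tsum [:: (b, m)].

Lemma tsumP s t : tsum s = tsum t <-> tensor_eq s t.
Proof.
split=> [/eqP|st]; last apply/eqP; rewrite /tsum eqmodE /=.
  by move/asboolP.
exact/asboolP.
Qed.

Lemma tsumK x : tsum (repr x) = x. Proof. exact: reprK. Qed.

Lemma repr_tsum s : tensor_eq (repr (tsum s)) s.
Proof. by apply/tsumP; rewrite tsumK. Qed.

Definition tensor_add (x y : tensor) : tensor := tsum (repr x ++ repr y).

Definition tensor_scale (b : B) (x : tensor) : tensor :=
  tsum [seq (b * p.1, p.2) | p <- repr x].

Definition tensor_opp : tensor -> tensor := tensor_scale (-1).

Lemma tensor_eq_scale b s t : tensor_eq s t ->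
  tensor_eq [seq (b * p.1, p.2) | p <- s] [seq (b * p.1, p.2) | p <- t].
Proof.
elim=> {s t} /=.
- by move=> s; exact: TensorRefl.
- by move=> s t _; exact: TensorSym.
- by move=> s t u _ + _; exact: TensorTrans.
- by move=> s s' t t' _ ? _ ?; rewrite !map_cat; exact: TensorCat.
- by move=> s t; rewrite !map_cat; exact: TensorC.
- by move=> m; rewrite mulr0; exact: Tensor0.
- by move=> c c' m; rewrite mulrDr; exact: TensorDl.
- by move=> c m m'; exact: TensorDr.
- by move=> c a m; rewrite mulrA; exact: TensorA.
Qed.

Lemma tensor_addE s t : tensor_add (tsum s) (tsum t) = tsum (s ++ t).
Proof. by apply/tsumP; apply: TensorCat; exact: repr_tsum. Qed.

Lemma tensor_scaleE b s :
  tensor_scale b (tsum s) = tsum [seq (b * p.1, p.2) | p <- s].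
Proof. by apply/tsumP; apply: tensor_eq_scale; exact: repr_tsum. Qed.

Lemma tensor_addA : associative tensor_add.
Proof.
move=> x y z; rewrite -(tsumK x) -(tsumK y) -(tsumK z).
rewrite (tensor_addE (repr y)) (tensor_addE (repr x) (repr y)).
by rewrite (tensor_addE _ (_ ++ _)) (tensor_addE (_ ++ _)) catA.
Qed.

Lemma tensor_addC : commutative tensor_add.
Proof. by move=> x y; apply/tsumP; exact: TensorC. Qed.

Lemma tensor_add0 : left_id (tsum [::]) tensor_add.
Proof. by move=> x; rewrite -(tsumK x) tensor_addE. Qed.

Lemma tensor_eq_cons p s t : tensor_eq s t -> tensor_eq (p :: s) (p :: t).
Proof. by move=> st; apply: (@TensorCat [:: p] [:: p]); first exact: TensorRefl. Qed.

Lemma tensor_eqDl b c s :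
  tensor_eq ([seq (b * p.1, p.2) | p <- s] ++ [seq (c * p.1, p.2) | p <- s])
            [seq ((b + c) * p.1, p.2) | p <- s].
Proof.
elim: s => [|[d m] s IH] /=; first exact: TensorRefl.
apply: TensorTrans.
  apply: tensor_eq_cons.
  rewrite -cat1s; apply: (TensorTrans (TensorC _ _)).
  rewrite /= -cat1s; apply: TensorCat; first exact: TensorRefl.
  apply: (TensorTrans (TensorC _ _)); exact: IH.
rewrite /= mulrDl.
by apply: (@TensorCat [:: _; _] [:: _]); [apply: TensorSym; exact: TensorDl | exact: TensorRefl].
Qed.

Lemma tensor_eq0 s : tensor_eq [seq (0 * p.1, p.2) | p <- s] [::].
Proof.
elim: s => [|[d m] s IH] /=; first exact: TensorRefl.
rewrite mul0r -cat1s -[X in tensor_eq _ X]cat0s.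
by apply: TensorCat; first exact: Tensor0.
Qed.

Lemma map_scale1 s : [seq (1 * p.1, p.2) | p <- s] = s :> seq (B * M).
Proof. by rewrite -[RHS]map_id; apply: eq_map => -[b m]; rewrite mul1r. Qed.

Lemma tensor_addN : left_inverse (tsum [::]) tensor_opp tensor_add.
Proof.
move=> x; rewrite -(tsumK x) /tensor_opp tensor_scaleE tensor_addE.
apply/tsumP; rewrite -{2}(map_scale1 (repr x)).
by apply: (TensorTrans (tensor_eqDl _ _ _)); rewrite addNr; exact: tensor_eq0.
Qed.

HB.instance Definition _ :=
  GRing.isZmodule.Build tensor tensor_addA tensor_addC tensor_add0 tensor_addN.

Lemma tsum_cat s t : tsum (s ++ t) = tsum s + tsum t.
Proof. by rewrite -tensor_addE. Qed.

Lemma tsum_nil : tsum [::] = 0. Proof. by []. Qed.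

Lemma tensor_scaleA a b x :
  tensor_scale a (tensor_scale b x) = tensor_scale (a * b) x.
Proof.
rewrite -(tsumK x) !tensor_scaleE -map_comp; congr tsum.
by apply: eq_map => -[c m] /=; rewrite mulrA.
Qed.

Lemma tensor_scale1 : left_id 1 tensor_scale.
Proof. by move=> x; rewrite -(tsumK x) tensor_scaleE map_scale1. Qed.

Lemma tensor_scaleDr : right_distributive tensor_scale +%R.
Proof.
move=> b x y; rewrite -(tsumK x) -(tsumK y) -tsum_cat !tensor_scaleE.
by rewrite map_cat tsum_cat.
Qed.

Lemma tensor_scaleDl x : {morph tensor_scale^~ x : a b / a + b}.
Proof.
move=> a b; rewrite -(tsumK x) !tensor_scaleE -tsum_cat.
by apply/tsumP; apply: TensorSym; exact: tensor_eqDl.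
Qed.

HB.instance Definition _ := GRing.Zmodule_isLmodule.Build B tensor
  tensor_scaleA tensor_scale1 tensor_scaleDr tensor_scaleDl.

Lemma tpureDl b b' m : tpure (b + b') m = tpure b m + tpure b' m.
Proof. by rewrite -tsum_cat; apply/tsumP; exact: TensorDl. Qed.

Lemma tpureDr b m m' : tpure b (m + m') = tpure b m + tpure b m'.
Proof. by rewrite -tsum_cat; apply/tsumP; exact: TensorDr. Qed.

Lemma tpureA b a m : tpure (b * f a) m = tpure b (a *: m).
Proof. by apply/tsumP; exact: TensorA. Qed.

Lemma tpureZ c b m : c *: tpure b m = tpure (c * b) m.
Proof. exact: (tensor_scaleE c [:: (b, m)]). Qed.

Lemma tsumE s : tsum s = \sum_(p <- s) tpure p.1 p.2.
Proof.
elim: s => [|[b m] s IH]; first by rewrite big_nil.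
by rewrite big_cons -IH -cat1s tsum_cat.
Qed.

Lemma tensor_ind (P : tensor -> Prop) : P 0 ->
  (forall x y, P x -> P y -> P (x + y)) ->
  (forall b m, P (tpure b m)) -> forall x, P x.
Proof.
move=> P0 PD Pp x; rewrite -(tsumK x) tsumE.
by apply: big_ind => // p _; exact: Pp.
Qed.

End Tensor.

Arguments tpure {A B} f {M} b m.

(** The map [b ⊗ m |-> k b *: h m].  It is given on representatives, so it is
    only meaningful for balanced data; [tlift_pure] and [tlift_additive] are the
    existence part of the universal property of [B ⊗_A M]. *)
Section Lift.
Variables (A B C : comNzRingType) (f : {rmorphism A -> B}) (k : B -> C).
Variables (M : lmodType A) (P : lmodType C).

Definition tlift (h : M -> P) (x : tensor f M) : P :=
  \sum_(p <- repr x) k p.1 *: h p.2.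

End Lift.

Section LiftTheory.
Variables (A B C : comNzRingType) (f : {rmorphism A -> B}).
Variables (k : {rmorphism B -> C}) (M : lmodType A) (P : lmodType C).
Variables (h : M -> P).
Hypothesis hD : {morph h : m m' / m + m'}.
Hypothesis hZ : forall a m, h (a *: m) = k (f a) *: h m.

Lemma tlift_eq (s t : seq (B * M)) : tensor_eq f s t ->
  \sum_(p <- s) k p.1 *: h p.2 = \sum_(p <- t) k p.1 *: h p.2.
Proof.
elim=> {s t} /=.
- by [].
- by move=> s t _ ->.
- by move=> s t u _ -> _ ->.
- by move=> s s' t t' _ e _ e'; rewrite !big_cat /= e e'.
- by move=> s t; rewrite !big_cat /= addrC.
- by move=> m; rewrite big_seq1 big_nil /= rmorph0 scale0r.
- by move=> b b' m; rewrite !big_cons !big_nil /= !addr0 rmorphD scalerDl.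
- by move=> b m m'; rewrite !big_cons !big_nil /= !addr0 hD scalerDr.
- by move=> b a m; rewrite !big_seq1 /= hZ rmorphM scalerA.
Qed.

Lemma tlift_sum s :
  tlift (f := f) k h (tsum f s) = \sum_(p <- s) k p.1 *: h p.2.
Proof. by rewrite /tlift; apply: tlift_eq; exact: repr_tsum. Qed.

Lemma tlift_pure b m : tlift k h (tpure f b m) = k b *: h m.
Proof. by rewrite /tpure tlift_sum big_seq1. Qed.

Lemma tlift_additive : {morph tlift (f := f) k h : x y / x + y}.
Proof.
move=> x y; rewrite -(tsumK x) -(tsumK y) -tsum_cat !tlift_sum.
by rewrite big_cat.
Qed.

Lemma tlift_scale b x : tlift (f := f) k h (b *: x) = k b *: tlift k h x.
Proof.
rewrite -(tsumK x) [b *: _]tensor_scaleE !tlift_sum big_map scaler_sumr.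
by apply: eq_bigr => p _; rewrite rmorphM scalerA.
Qed.

End LiftTheory.

(** The canonical isomorphism [E ⊗_S (S ⊗_R M) -> E ⊗_F (F ⊗_R M)],
    [e ⊗ (s ⊗ m) |-> (e * s) ⊗ (1 ⊗ m)], attached to a commutative square of
    rings. *)
Section Swap.
Variables (R S F E : comNzRingType).
Variables (iota : {rmorphism R -> F}) (g : {rmorphism F -> E}).
Variables (rho : {rmorphism R -> S}) (j : {rmorphism S -> E}).
Variable M : lmodType R.

Definition tensor_swap :
    tensor j (tensor rho M) -> tensor g (tensor iota M) :=
  tlift idfun (tlift j (fun m => tpure g 1 (tpure iota 1 m))).

Hypothesis square : forall a, j (rho a) = g (iota a).

Let h (m : M) := tpure g 1 (tpure iota 1 m).

Let hD : {morph h : m m' / m + m'}.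
Proof. by move=> m m'; rewrite /h !tpureDr. Qed.

Let hZ a m : h (a *: m) = j (rho a) *: h m.
Proof.
have e : tpure iota 1 (a *: m) = iota a *: tpure iota 1 m.
  by rewrite -tpureA mul1r tpureZ mulr1.
by rewrite /h e -tpureA mul1r square tpureZ mulr1.
Qed.

Let kD := tlift_additive (f := rho) hD hZ.
Let kZ := tlift_scale (f := rho) hD hZ.

Lemma tensor_swapD : {morph tensor_swap : x y / x + y}.
Proof. exact: (tlift_additive (k := idfun) kD kZ). Qed.

Lemma tensor_swapZ e x : tensor_swap (e *: x) = e *: tensor_swap x.
Proof. exact: (tlift_scale (k := idfun) kD kZ). Qed.

Lemma tensor_swap_pure e s m :
  tensor_swap (tpure j e (tpure rho s m)) =
    tpure g (e * j s) (tpure iota 1 m).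
Proof.
rewrite /tensor_swap (tlift_pure (k := idfun) kD kZ) (tlift_pure hD hZ).
by rewrite scalerA tpureZ mulr1.
Qed.

End Swap.

Arguments tensor_swap {R S F E} iota g rho j {M} x.

Section SwapIso.
Variables (R S F E : comNzRingType).
Variables (iota : {rmorphism R -> F}) (g : {rmorphism F -> E}).
Variables (rho : {rmorphism R -> S}) (j : {rmorphism S -> E}).
Variable M : lmodType R.
Hypothesis square : forall a, j (rho a) = g (iota a).

Lemma tensor_swapK :
  cancel (tensor_swap iota g rho j (M := M)) (tensor_swap rho j iota g (M := M)).
Proof.
have square' a : g (iota a) = j (rho a) by rewrite square.
have swap0 : tensor_swap iota g rho j (0 : tensor j (tensor rho M)) = 0.
  by rewrite -(scale0r (0 : tensor j _)) tensor_swapZ // scale0r.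
have swap0' : tensor_swap rho j iota g (0 : tensor g (tensor iota M)) = 0.
  by rewrite -(scale0r (0 : tensor g _)) tensor_swapZ // scale0r.
elim/tensor_ind => [|x y xK yK|e].
- by rewrite swap0 swap0'.
- by rewrite !tensor_swapD // xK yK.
elim/tensor_ind => [|x y xK yK|s m].
- have -> : tpure j e (0 : tensor rho M) = 0.
    by apply: (addrI (tpure j e 0)); rewrite -tpureDr !addr0.
  by rewrite swap0 swap0'.
- by rewrite tpureDr !tensor_swapD // xK yK.
rewrite !tensor_swap_pure // rmorph1 mulr1 tpureA.
by rewrite tpureZ mulr1.
Qed.

End SwapIso.

Section QuadraticForm.
Variables (F : fieldType) (V : lmodType F).
Implicit Types Q : V -> F.

Definition polar Q (u v : V) : F := Q (u + v) - Q u - Q v.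

Lemma polarC Q u v : polar Q u v = polar Q v u.
Proof. by rewrite /polar [u + v]addrC addrAC. Qed.

Definition quadratic_form Q : Prop :=
  (forall a v, Q (a *: v) = a ^+ 2 * Q v) /\
  bilinear_for *%R *%R (polar Q).

Definition nondegenerate_form Q : Prop :=
  forall u, (forall v, polar Q u v = 0) -> u = 0.

End QuadraticForm.

(** The form [Q_E] on [E ⊗_F V] deduced from [Q] by extension of scalars:
    [Q_E (\sum_i e_i ⊗ v_i)] is the sum of the [e_i ^ 2 * Q v_i] and of the
    [e_i * e_j * polar Q v_i v_j] for [i < j].  By [ext_form_quadratic] and
    [ext_form_pure] it is a quadratic form restricting to [Q]. *)
Section ExtendForm.
Variables (F E : fieldType) (g : {rmorphism F -> E}) (V : lmodType F).
Variable Q : V -> F.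

Definition polar_sum (s t : seq (E * V)) : E :=
  \sum_(p <- s) \sum_(q <- t) p.1 * q.1 * g (polar Q p.2 q.2).

Fixpoint form_sum (s : seq (E * V)) : E :=
  if s is p :: s' then
    p.1 ^+ 2 * g (Q p.2) + polar_sum [:: p] s' + form_sum s'
  else 0.

Definition ext_form (x : tensor g V) : E := form_sum (repr x).

Hypothesis QP : quadratic_form Q.

Lemma polarDr u v w : polar Q u (v + w) = polar Q u v + polar Q u w.
Proof. by have := QP.2.2 u 1 v w; rewrite /= scale1r mul1r. Qed.

Lemma polarZr a u v : polar Q u (a *: v) = a * polar Q u v.
Proof.
have p0 : polar Q u 0 = 0.
  by apply: (addrI (polar Q u 0)); rewrite -polarDr !addr0.
by have := QP.2.2 u a v 0; rewrite /= !addr0 p0 addr0.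
Qed.

Lemma polar_sumC s t : polar_sum s t = polar_sum t s.
Proof.
rewrite /polar_sum exchange_big /=; apply: eq_bigr => q _.
by apply: eq_bigr => p _; rewrite polarC [p.1 * _]mulrC.
Qed.

Lemma polar_sum_catl s s' t :
  polar_sum (s ++ s') t = polar_sum s t + polar_sum s' t.
Proof. by rewrite /polar_sum big_cat. Qed.

Lemma polar_sum_catr s t t' :
  polar_sum s (t ++ t') = polar_sum s t + polar_sum s t'.
Proof. by rewrite polar_sumC polar_sum_catl !(polar_sumC s). Qed.

Lemma polar_sum_eqr s t t' :
  tensor_eq g t t' -> polar_sum s t = polar_sum s t'.
Proof.
move=> tt'; rewrite /polar_sum; apply: eq_bigr => p _.
pose h v : E^o := p.1 * g (polar Q p.2 v).
have hD : {morph h : m m' / m + m'}.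
  by move=> v w; rewrite /h polarDr rmorphD mulrDr.
have hZ a v : h (a *: v) = idfun (g a) *: h v.
  by rewrite /h polarZr rmorphM mulrCA.
have := tlift_eq (k := idfun) hD hZ tt'.
have e (u : seq (E * V)) : \sum_(q <- u) p.1 * q.1 * g (polar Q p.2 q.2) =
    \sum_(q <- u) idfun q.1 *: h q.2.
  by apply: eq_bigr => q _; rewrite /h [p.1 * _]mulrC -mulrA.
by rewrite !e.
Qed.

Lemma form_sum_cat s t :
  form_sum (s ++ t) = form_sum s + form_sum t + polar_sum s t.
Proof.
elim: s => [|p s IH] /=; first by rewrite add0r /polar_sum big_nil addr0.
have -> : polar_sum (p :: s) t = polar_sum [:: p] t + polar_sum s t.
  by rewrite -cat1s polar_sum_catl.
by rewrite IH polar_sum_catr; ring.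
Qed.

Lemma form_sum_eq s t : tensor_eq g s t -> form_sum s = form_sum t.
Proof.
have Qmm m : polar Q m m = Q m *+ 2.
  rewrite /polar -mulr2n -scaler_nat QP.1; ring.
elim=> {s t} /=.
- by [].
- by move=> s t _ ->.
- by move=> s t u _ -> _ ->.
- move=> s s' t t' ss' IHs tt' IHt; rewrite !form_sum_cat IHs IHt.
  rewrite (polar_sum_eqr _ tt') polar_sumC (polar_sum_eqr _ ss').
  by rewrite polar_sumC.
- move=> s t; rewrite !form_sum_cat polar_sumC; congr (_ + _); exact: addrC.
- by move=> m; rewrite /polar_sum big_seq1 big_nil expr0n mul0r !addr0.
- move=> b b' m; rewrite /polar_sum !big_seq1 !big_nil /= Qmm rmorphMn /=; ring.
- move=> b m m'; rewrite /polar_sum !big_seq1 !big_nil /=.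
  have -> : Q (m + m') = Q m + Q m' + polar Q m m' by rewrite /polar; ring.
  rewrite !rmorphD /=; ring.
- move=> b a m; rewrite /polar_sum !big_seq1 !big_nil QP.1 rmorphM rmorphXn /=.
  ring.
Qed.

Lemma ext_form_sum s : ext_form (tsum g s) = form_sum s.
Proof. by apply: form_sum_eq; exact: repr_tsum. Qed.

Lemma ext_form_pure e v : ext_form (tpure g e v) = e ^+ 2 * g (Q v).
Proof. by rewrite ext_form_sum /= /polar_sum big_seq1 big_nil !addr0. Qed.

Lemma polar_ext_form s t :
  polar ext_form (tsum g s) (tsum g t) = polar_sum s t.
Proof. by rewrite /polar -tsum_cat !ext_form_sum form_sum_cat; ring. Qed.

Lemma ext_form_quadratic : quadratic_form ext_form.
Proof.
have scale (e : E) (s : seq (E * V)) :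
  e *: tsum g s = tsum g [seq (e * p.1, p.2) | p <- s].
  exact: tensor_scaleE.
have polar_scale e (s t : seq (E * V)) :
    polar_sum [seq (e * p.1, p.2) | p <- s] t = e * polar_sum s t.
  rewrite /polar_sum big_map mulr_sumr; apply: eq_bigr => p _.
  by rewrite mulr_sumr; apply: eq_bigr => q _; rewrite !mulrA.
have lin t e (u w : tensor g V) : polar ext_form (e *: u + w) t =
    e * polar ext_form u t + polar ext_form w t.
  rewrite -(tsumK u) -(tsumK w) -(tsumK t) scale -tsum_cat !polar_ext_form.
  by rewrite polar_sum_catl polar_scale.
split.
  move=> e x; rewrite -(tsumK x) scale !ext_form_sum.
  elim: (repr x) => [|p s IH] /=; first by rewrite mulr0.
  rewrite IH !mulrDr exprMn !mulrA; congr (_ + _ + _).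
  rewrite -[[:: _]]/[seq (e * p.1, p.2) | p <- [:: p]] polar_scale.
  by rewrite polar_sumC polar_scale polar_sumC; ring.
split=> u e v w; first exact: lin.
by rewrite /= [LHS]polarC lin (polarC _ v) (polarC _ w).
Qed.

End ExtendForm.

Section IntegralClosure.
Variables (A : comNzRingType) (E : fieldType) (g : {rmorphism A -> E}).

Definition integral_pred : {pred E} := fun x => `[< integralOver g x >].

Lemma integral_subring : subring_closed integral_pred.
Proof.
split.
- by apply/asboolP; exact: integral1.
- by move=> x y /asboolP ? /asboolP ?; apply/asboolP; exact: integral_sub.
- by move=> x y /asboolP ? /asboolP ?; apply/asboolP; exact: integral_mul.
Qed.

HB.instance Definition _ :=
  GRing.isSubringClosed.Build E integral_pred integral_subring.

Definition integral_closure := {x : E | x \in integral_pred}.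

HB.instance Definition _ := SubChoice.on integral_closure.
HB.instance Definition _ := [SubChoice_isSubComNzRing of integral_closure by <:].

Definition closure_val : {rmorphism integral_closure -> E} :=
  [the {rmorphism _ -> _} of val].

Lemma integral_mem a : g a \in integral_pred.
Proof. by apply/asboolP; exact: integral_id. Qed.

Definition closure_in (a : A) : integral_closure := Sub (g a) (integral_mem a).

Lemma closure_in_additive : zmod_morphism closure_in.
Proof. by move=> a b; apply: val_inj; rewrite /= rmorphB. Qed.

Lemma closure_in_multiplicative : monoid_morphism closure_in.
Proof.
by split=> [|a b]; apply: val_inj; rewrite /= ?rmorph1 ?rmorphM.
Qed.

HB.instance Definition _ :=
  GRing.isZmodMorphism.Build A integral_closure closure_in closure_in_additive.
HB.instance Definition _ := GRing.isMonoidMorphism.Build A integral_closure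
  closure_in closure_in_multiplicative.

Definition closure_map : {rmorphism A -> integral_closure} :=
  [the {rmorphism _ -> _} of closure_in].

End IntegralClosure.

Section Lattice.
Variables (A : comNzRingType) (K : fieldType) (iota : {rmorphism A -> K}).

Definition finitely_generated (M : lmodType A) : Prop :=
  exists s : seq M, forall x, exists c : 'I_(size s) -> A,
    x = \sum_(i < size s) c i *: s`_i.

Definition torsion_free (M : lmodType A) : Prop :=
  forall (a : A) (x : M), a *: x = 0 -> a = 0 \/ x = 0.

(* [K] is meant to be the fraction field of [A] and [iota] the inclusion. *)
Record quadratic_module := QuadraticModule {
  qmod :> lmodType A;
  qform : tensor iota qmod -> K
}.

Definition quadratic_lattice (M : quadratic_module) : Prop :=
  [/\ finitely_generated M, torsion_free M,
      quadratic_form (qform (q := M)) & nondegenerate_form (qform (q := M))].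

Definition embeds (N M : quadratic_module) : Prop :=
  exists sigma : {linear N -> M},
    forall x : N, qform (tpure iota 1 x) = qform (tpure iota 1 (sigma x)).

End Lattice.

Section ExtendLattice.
Variables (R S : comNzRingType) (F E : fieldType).
Variables (iota : {rmorphism R -> F}) (g : {rmorphism F -> E}).
Variables (rho : {rmorphism R -> S}) (j : {rmorphism S -> E}).

Definition extend_lattice (M : quadratic_module iota) : quadratic_module j :=
  @QuadraticModule S E j (tensor rho M)
    (fun x => ext_form (qform (q := M)) (tensor_swap iota g rho j x)).

Hypothesis square : forall a, j (rho a) = g (iota a).

Lemma extend_lattice_formE (M : quadratic_module iota) s (m : M) :
  quadratic_form (qform (q := M)) ->
  qform (q := extend_lattice M) (tpure j 1 (tpure rho s m)) =
    j s ^+ 2 * g (qform (tpure iota 1 m)).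
Proof.
by move=> QP; rewrite /= tensor_swap_pure // mul1r ext_form_pure.
Qed.

End ExtendLattice.

(** [S ⊗_R M] as a quadratic lattice over the integral closure [S] of [R] in a
    finite extension [E] of the fraction field of [R]. *)
Section Statement.
Variables (R : idomainType) (E : fieldExtType {fraction R}).

Definition frac_map : {rmorphism R -> {fraction R}} :=
  [the {rmorphism _ -> _} of @tofrac R].

Definition frac_ext : {rmorphism {fraction R} -> E} :=
  [the {rmorphism _ -> _} of in_alg E].

Definition ring_ext : {rmorphism R -> E} :=
  [the {rmorphism _ -> _} of frac_ext \o frac_map].

Definition base_change (M : quadratic_module frac_map) :
    quadratic_module (closure_val ring_ext) :=
  extend_lattice frac_ext (closure_map ring_ext) (closure_val ring_ext) M.

End Statement.

(* Main.v *)
From HB Require Import structures.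
Require Import Defs.
From mathcomp Require Import all_boot all_algebra all_field.
From mathcomp Require Import ring zify boolp.
Import GRing.Theory.
Local Open Scope ring_scope.

(** Only the descent from [S] to [R] has content: an isometry over [R] extends
    linearly to [S].

    Since [2] is a unit and [R] is a valuation ring, [M] and [N] have orthogonal
    bases, with norms [a_k] and [b_1 | b_2 | ... | b_n] ([lattice_basis]).  An
    embedding of [S ⊗ N] into [S ⊗ M] is then a family of orthogonal vectors
    [z_1, ..., z_n] with coordinates in [S] and norms [b_1, ..., b_n], and
    vectors [y_1, ..., y_n] with coordinates in [R] and the same Gram matrix are
    wanted.  They are found one at a time, [y_j] being searched for in the
    sublattice [M_j] of [M] spanned by the basis vectors whose norm divides
    [b_j].  Four facts make the step from [y_1, ..., y_(j-1)] to [y_j] work.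

    - Forgetting the coordinates of [z_1, ..., z_j] outside [M_j] changes their
      Gram matrix by multiples of [t * b_j], where [t] is a uniformizer of [R].
      Such an error can be repaired over [E] by the Gram-Schmidt process
      ([normalize_system]), because [1 + t * s] is a square for [s] in [S]
      ([integral_inv_sqrt], a consequence of completeness).
    - By Witt's theorem ([witt_complement]) the orthogonal complement of
      [y_1, ..., y_(j-1)] in [E ⊗ M_j] therefore represents [b_j].
    - By Springer's theorem on odd degree extensions of fields
      ([springer_represent]) so does the complement [V] of
      [y_1, ..., y_(j-1)] in [F ⊗ M_j], up to the square of a scalar that may
      vanish: [Q v = b_j * c ^+ 2] for some nonzero [v] of [V].
    - A vector of norm [b_j] can then be found in the lattice of the points of
      [V] that have coordinates in [R] ([represent_integral]).  Scale [v] to be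
      primitive.  Either [1 / c] is in [R], and [v / c] will do, or [t] divides
      [c].  In the second case, as [b_j] is a multiple of all the norms of the
      bases of [M_j] and of [y_1, ..., y_(j-1)], that lattice contains some [f]
      with [B v f = b_j] and [Q f] in [b_j R].  Now [Q (X v + f) = b_j] is a
      quadratic equation for [X], linear modulo [t] with a unit as linear
      coefficient, and Hensel's lemma solves it in [R]. *)

Set Implicit Arguments.
Unset Strict Implicit.
Unset Printing Implicit Defensive.

(** * Discrete valuation rings *)

Section DiscreteValuation.
Variable R : idomainType.
Implicit Types (x y p t u : R).

(** The multiples of the [x n] form an ideal.  Its generator is a multiple of some
    [x n] and divides [x n.+1], which makes [y n] a unit. *)
Lemma proper_divisor_chain (x y : nat -> R) : principal_ideal_domain R ->
  (forall n, x n = y n * x n.+1) -> (forall n, x n != 0) ->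
  exists n, y n \is a GRing.unit.
Proof.
move=> pid xS x0.
case: (pselect (exists n, x n \is a GRing.unit)) => [[n xu]|xN].
  by exists n; move: xu; rewrite xS unitrM => /andP[].
have mono d n : exists c, x n = c * x (n + d)%N.
  elim: d => [|d [c e]]; first by exists 1; rewrite addn0 mul1r.
  by exists (c * y (n + d)%N); rewrite e xS addnS mulrA.
pose I : {pred R} := fun z => `[< exists n c, z = c * x n >].
have idI : idealr_closed I.
  split.
  - by apply/asboolP; exists 0%N, 0; rewrite mul0r.
  - apply/asboolP => -[n [c e]]; apply: xN; exists n.
    by apply/unitrP; exists c; rewrite -e mulrC -e.
  - move=> a u v /asboolP[n [c ->]] /asboolP[m [d ->]]; apply/asboolP.
    have [e1 h1] := mono m n; have [e2 h2] := mono n m.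
    exists (n + m)%N, (a * c * e1 + d * e2).
    by rewrite mulrDl {1}h1 {1}h2 [(m + n)%N]addnC !mulrA.
have [a ha] := pid I idI.
have /asboolP[n [c ac]] : a \in I by apply/ha; exists 1; rewrite mul1r.
have /ha[d xd] : x n.+1 \in I by apply/asboolP; exists n.+1, 1; rewrite mul1r.
exists n; apply/unitrP; exists (d * c).
suff e : d * c * y n = 1 by rewrite [y n * _]mulrC e.
apply: (mulIf (x0 n.+1)).
by rewrite mul1r -mulrA -xS -mulrA -ac -xd.
Qed.

(** If no divisor of [x] were irreducible, dependent choice would yield an endless
    chain of proper divisors. *)
Lemma irreducible_divisor x : principal_ideal_domain R ->
  x != 0 -> x \isn't a GRing.unit ->
  exists p c, [/\ x = c * p, p \isn't a GRing.unit &
    forall a b, p = a * b -> a \is a GRing.unit \/ b \is a GRing.unit].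
Proof.
move=> pid x0 xN; apply: contrapT => noirr.
pose D := {p : R | p \isn't a GRing.unit /\ exists c, x = c * p}.
have step (p : D) : exists q : D, exists2 a : R,
    sval p = a * sval q & a \isn't a GRing.unit.
  case: p => p [pN [c xc]] /=; apply: contrapT => nostep.
  apply: noirr; exists p, c; split => // a b pab.
  apply: contrapT => /not_orP[/negP aN /negP bN]; apply: nostep.
  have bD : b \isn't a GRing.unit /\ exists c, x = c * b.
    by split => //; exists (c * a); rewrite xc pab mulrA.
  by exists (exist _ b bD), a.
pose next (q : D) := sval (cid (step q)).
have x_self : x \isn't a GRing.unit /\ exists c, x = c * x.
  by split => //; exists 1; rewrite mul1r.
pose s n := iter n next (exist _ x x_self).
have sP n : exists2 a : R, sval (s n) = a * sval (s n.+1) &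
  a \isn't a GRing.unit by exact: svalP (cid (step (s n))).
pose y n := sval (cid2 (sP n)).
have [n] : exists n, y n \is a GRing.unit.
  apply: (@proper_divisor_chain (fun n => sval (s n)) y pid) => n.
    by rewrite /y; case: cid2.
  case: (s n) => q [qN [c /= xc]].
  by apply: contraNneq x0 => q0; rewrite xc q0 mulr0.
by rewrite /y; case: (cid2 (sP n)) => a _ /= /negP aN /aN.
Qed.

(** If [p] divides [u * v] but not [v], then [1] is in the ideal generated by [p]
    and [v]: a generator of this ideal divides [p] and, as it divides [v], is not
    associate to [p]. *)
Lemma irreducible_prime_ideal p : principal_ideal_domain R ->
  p != 0 -> p \isn't a GRing.unit ->
  (forall a b, p = a * b -> a \is a GRing.unit \/ b \is a GRing.unit) ->
  nonzero_prime_ideal (fun z => `[< exists c, z = c * p >]).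
Proof.
move=> pid p0 pN irr; split; last first.
- by exists p => //; apply/asboolP; exists 1; rewrite mul1r.
- move=> u v /asboolP[w uvw]; apply/orP.
  case: (pselect (exists c, v = c * p)) => [pv|pv]; first by right; apply/asboolP.
  left; apply/asboolP.
  pose J : {pred R} := fun z => `[< exists a b, z = a * p + b * v >].
  suff [a [b e]] : exists a b, 1 = a * p + b * v.
    exists (u * a + b * w); rewrite -[LHS]mulr1 e mulrDr mulrDl.
    by rewrite [u * (b * v)]mulrCA uvw !mulrA.
  apply: contrapT => J1.
  have [d hd] : exists d, generates d J.
    apply: pid; split; first by apply/asboolP; exists 0, 0; rewrite !mul0r addr0.
      exact/asboolP.
    move=> a _ _ /asboolP[a1 [b1 ->]] /asboolP[a2 [b2 ->]]; apply/asboolP.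
    by exists (a * a1 + a2), (a * b1 + b2); ring.
  have [c pc] : exists c, p = c * d.
    by apply/hd/asboolP; exists 1, 0; rewrite mul1r mul0r addr0.
  have [e ve] : exists c, v = c * d.
    by apply/hd/asboolP; exists 0, 1; rewrite mul1r mul0r add0r.
  case: (irr _ _ pc) => [cu|du].
    by apply: pv; exists (e / c); rewrite pc mulrA divrK.
  have /hd/asboolP : exists c, 1 = c * d by exists d^-1; rewrite mulVr.
  by move=> [a [b ab]]; apply: J1; exists a, b.
- split; first by apply/asboolP; exists 0; rewrite mul0r.
    apply/asboolP => -[c e]; move/negP: pN; apply.
    by apply/unitrP; exists c; rewrite -e mulrC -e.
  move=> a _ _ /asboolP[c ->] /asboolP[d ->]; apply/asboolP.
  by exists (a * c + d); rewrite mulrDl mulrA.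
Qed.

Variable t : R.
Hypotheses (dvr : discrete_valuation_ring R) (tP : uniformizer t).

Lemma uniformizer_nonunit : t \isn't a GRing.unit.
Proof.
have [P [[P0 P1 PD] _ _] gen] := tP.
apply/negP => tu; move/negP: P1; apply; apply/gen.
by exists t^-1; rewrite mulVr.
Qed.

Lemma uniformizer_neq0 : t != 0.
Proof.
have [P [_ _ [x xP x0]] gen] := tP; have [c xc] := (gen x).1 xP.
by apply: contraNneq x0 => t0; rewrite xc t0 mulr0.
Qed.

(** An irreducible factor of [x] generates a nonzero prime ideal, and the only one
    is generated by [t]. *)
Lemma uniformizer_dvd x : x \isn't a GRing.unit -> exists c, x = c * t.
Proof.
have [-> _|x0 xN] := eqVneq x 0; first by exists 0; rewrite mul0r.
have [pid [Q [_ Quniq]]] := dvr.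
have [P Pprime Pgen] := tP.
have [p [c [xc pN irr]]] := irreducible_divisor pid x0 xN.
have p0 : p != 0 by apply: contraNneq x0 => q0; rewrite xc q0 mulr0.
have pprime := irreducible_prime_ideal pid p0 pN irr.
have /Pgen[d pd] : p \in P.
  rewrite Quniq // -(Quniq _ pprime); apply/asboolP.
  by exists 1; rewrite mul1r.
by exists (c * d); rewrite xc pd mulrA.
Qed.

(** If [t] could be divided out forever, the quotients would form an endless chain
    of proper divisors. *)
Lemma uniformizer_factor x : x != 0 ->
  exists n u, u \is a GRing.unit /\ x = u * t ^+ n.
Proof.
move=> x0; apply: contrapT => nofac.
have dvd n : exists c, x = c * t ^+ n.
  elim: n => [|n [c xc]]; first by exists x; rewrite mulr1.
  have [cu|/uniformizer_dvd[d cd]] := boolP (c \is a GRing.unit).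
    by case: nofac; exists n, c.
  by exists d; rewrite xc cd exprS mulrA.
pose y n := sval (cid (dvd n)).
have yP n : x = y n * t ^+ n by rewrite /y; case: cid.
have t0 := uniformizer_neq0.
have [n tu] : exists n : nat, t \is a GRing.unit.
  apply: (@proper_divisor_chain y (fun=> t) dvr.1) => n.
    apply: (mulIf (expf_neq0 n t0)); rewrite -yP {1}(yP n.+1) exprS.
    by rewrite mulrA [t * _]mulrC.
  by apply: contraNneq x0 => y0; rewrite (yP n) y0 mul0r.
by move/negP: uniformizer_nonunit; apply.
Qed.

Variables (K : fieldType) (g : {rmorphism R -> K}).

Lemma ratio_uniformizer a b : injective g -> a != 0 -> b != 0 ->
  (exists n u, u \is a GRing.unit /\ g a / g b = g (u * t ^+ n)) \/
  (exists n u, u \is a GRing.unit /\ (g a / g b)^-1 = g (u * t ^+ n.+1)).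
Proof.
move=> g_inj a0 b0.
have [n [u [uu ->]]] := uniformizer_factor a0.
have [m [v [vu ->]]] := uniformizer_factor b0.
have g0 (c : R) : c != 0 -> g c != 0 by rewrite -(rmorph0 g) (inj_eq g_inj).
have gu (c : R) : c \is a GRing.unit -> g c != 0.
  by move=> cu; apply: g0; apply: contraTneq cu => ->; rewrite unitr0.
have t0 := g0 _ uniformizer_neq0; have u0 := gu _ uu; have v0 := gu _ vu.
have [le_mn|lt_nm] := leqP m n; [left|right].
  exists (n - m)%N, (u / v); split; first by rewrite unitrM uu unitrV.
  rewrite -{1}(subnK le_mn) exprD !rmorphM !rmorphXn /= rmorphV //.
  by field; rewrite v0 expf_neq0.
exists (m - n.+1)%N, (v / u); split; first by rewrite unitrM vu unitrV.
rewrite -subSn // subSS -{1}(subnK (ltnW lt_nm)) exprD !rmorphM !rmorphXn /=.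
by rewrite rmorphV //; field; rewrite v0 u0 !expf_neq0.
Qed.

End DiscreteValuation.

Lemma frac_map_inj (R : idomainType) : injective (frac_map R).
Proof. by move=> a b /eqP; rewrite /= tofrac_eq => /eqP. Qed.

Lemma frac_ratio (R : idomainType) (x : {fraction R}) : exists a b,
  b != 0 /\ x = frac_map R a / frac_map R b.
Proof.
elim/quotW: x => -[[a b] /= b0]; exists a, b; split => //.
have fb0 : frac_map R b != 0 by rewrite /= tofrac_eq0.
apply: (mulIf fb0); rewrite divfK //=.
rewrite -[LHS]/(FracField.mul _ _) !piE; apply/eqmodP.
rewrite /= FracField.equivfE /FracField.mulf /=.
by rewrite !numden_Ratio ?mulr1 ?oner_eq0 // mulrC.
Qed.

(** * Square roots over a complete ring *)

Section Hensel.
Import Pdiv.Ring Pdiv.RingMonic.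
Variables (R : idomainType) (t : R).
Hypothesis t_complete : forall u, adic_cauchy t u -> exists l, adic_limit t u l.

(** Completeness of [R] passes to polynomials of bounded size, coefficient by
    coefficient.  This is how it will reach the rings [R[s]], where [s] is
    integral over [R]. *)
Lemma adic_poly_limit n (q : nat -> {poly R}) :
  (forall k, (size (q k) <= n)%N) ->
  (forall k, exists d, q k.+1 - q k = t ^+ k *: d) ->
  exists l, forall k, exists d, l - q k = t ^+ k *: d.
Proof.
move=> q_size q_step.
have q_diff k i : exists d, q (k + i)%N - q k = t ^+ k *: d.
  elim: i => [|i [d e]]; first by exists 0; rewrite addn0 subrr scaler0.
  have [d' e'] := q_step (k + i)%N.
  exists (t ^+ i *: d' + d); rewrite addnS scalerDr scalerA -exprD -e -e'.
  by rewrite addrA subrK.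
have coord_limit j : exists l, forall k, exists c, l - (q k)`_j = c * t ^+ k.
  have [|l ul] := @t_complete (fun k => (q k)`_j).
    move=> n'; exists n' => i i' /subnKC <- /subnKC <-.
    have [d e] := q_diff n' (i - n')%N; have [d' e'] := q_diff n' (i' - n')%N.
    exists (d`_j - d'`_j); rewrite mulrBl mulrC -coefZ -e [d'`_j * _]mulrC.
    by rewrite -coefZ -e' !coefB; ring.
  exists l => k; have [i ik] := ul k.
  have [c uc] := ik _ (leq_addl k i); have [d e] := q_diff k i.
  exists (d`_j - c); rewrite mulrBl -uc mulrC -coefZ -e coefB; ring.
pose L j := sval (cid (coord_limit j)).
have LP j k : exists c, L j - (q k)`_j = c * t ^+ k.
  by rewrite /L; case: cid.
exists (\poly_(j < n) L j) => k.
exists (\poly_(j < n) sval (cid (LP j k))).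
apply/polyP => j; rewrite coefB coefZ !coef_poly.
case: ltnP => [_|le_nj]; first by case: cid => c /= ->; rewrite mulrC.
by rewrite nth_default ?subrr ?mulr0 // (leq_trans (q_size k)).
Qed.

Variables (K : fieldType) (g : {rmorphism R -> K}).
Local Notation S := (integral_pred g).
Hypotheses (tN : t \isn't a GRing.unit) (t0 : t != 0) (g_inj : injective g).
Hypothesis S_sep : forall x, x \in S -> x != 0 ->
  exists m, g t ^+ m / x \in S.

Let gt0 : g t != 0.
Proof. by rewrite -(rmorph0 g) (inj_eq g_inj). Qed.

(** Clearing denominators in an integral equation of [(g t)^-1] shows that [t]
    divides [1]. *)
Lemma integral_inv_nonunit : (g t)^-1 \notin S.
Proof.
apply/asboolP => -[p p_monic /rootP]; rewrite horner_coef.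
rewrite size_map_inj_poly ?rmorph0 //.
have sp : size p = (size p).-1.+1 by rewrite prednK // size_poly_gt0 monic_neq0.
set n := (size p).-1 in sp; rewrite sp => p_root.
have : g (\sum_(i < n.+1) p`_i * t ^+ (n - i)) = 0.
  transitivity (g t ^+ n * 0); last exact: mulr0.
  rewrite -[in RHS]p_root rmorph_sum mulr_sumr /=.
  apply: eq_bigr => i _; rewrite coef_map rmorphM rmorphXn /= mulrCA.
  congr (_ * _); have le_in : (i <= n)%N by rewrite -ltnS.
  by rewrite exprVn -expfB_cond ?(negPf gt0).
rewrite -(rmorph0 g) => /g_inj; rewrite big_ord_recr /= subnn mulr1.
have -> : p`_n = 1 by exact/eqP.
move=> e; move/negP: tN; apply; apply/unitrP.
exists (- \sum_(i < n) p`_i * t ^+ (n - i).-1).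
suff e1 : - (\sum_(i < n) p`_i * t ^+ (n - i).-1) * t = 1.
  by rewrite [t * _]mulrC e1.
apply/eqP; rewrite mulNr eq_sym -addr_eq0 addrC mulr_suml -[eqbRHS]e.
apply/eqP; congr (_ + _); apply: eq_bigr => i _.
by rewrite -mulrA -exprSr prednK // subn_gt0.
Qed.

(** For [x != 0], both [g t ^+ m / x] and [x / g t ^+ m.+1] would be integral for
    some [m], hence [(g t)^-1] too. *)
Lemma integral_separated x :
  (forall k, exists2 y, y \in S & x = g t ^+ k * y) -> x = 0.
Proof.
move=> xdiv; apply: contraTeq isT => x0.
have [y yS] := xdiv 0%N; rewrite mul1r => xy; rewrite -xy in yS.
have [m mS] := S_sep yS x0.
have [z zS xz] := xdiv m.+1.
have z0 : z != 0 by apply: contraNneq x0 => z0; rewrite xz z0 mulr0.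
have /negP[] := integral_inv_nonunit.
suff -> : (g t)^-1 = g t ^+ m / x * z by rewrite rpredM.
by rewrite xz exprS; field; rewrite z0 gt0 expf_neq0.
Qed.

Hypothesis unit2 : (2 : R) \is a GRing.unit.

(** With [d = 1 + t * X], the equation becomes [X = Phi X] for a polynomial map
    [Phi] that contracts [t]-adically, [2] being invertible.  The fixed point is
    the limit of the iterates of [Phi] in [R[X]] modulo a monic equation of [s]:
    there sizes are bounded, so that the limit exists, and it can be evaluated at
    [s]. *)
Lemma integral_inv_sqrt s : s \in S ->
  exists2 d, d \in S & d ^+ 2 * (1 + g t * s) = 1.
Proof.
move=> sS; have /asboolP[p p_monic /rootP ps0] := sS.
pose h := (2^-1 : R)%:P; pose T := t%:P.
have h2 : 2 * h = 1 by rewrite /h -[2](rmorph_nat (@polyC R)) -rmorphM divrr.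
pose Phi (q : {poly R}) :=
  - h * ('X + T * (2 * 'X * q + q ^+ 2 + T * 'X * q ^+ 2)).
(* The divided difference of [Phi], up to the factor [T]. *)
pose Psi (q r : {poly R}) := - h * (2 * 'X + (q + r) + T * 'X * (q + r)).
have PhiB q r : Phi q - Phi r = T * (q - r) * Psi q r.
  by rewrite /Phi /Psi; ring.
pose q k := iter k (fun r => rmodp (Phi r) p) 0.
have q_size k : (size (q k) <= size p)%N.
  case: k => [|k]; first by rewrite size_poly0.
  by rewrite ltnW // ltn_rmodpN0 // monic_neq0.
have q_step k : exists d, q k.+1 - q k = t ^+ k *: d.
  elim: k => [|k [d e]]; first by exists (q 1%N - q 0%N); rewrite scale1r.
  exists (rmodp (d * Psi (q k.+1) (q k)) p).
  rewrite -rmodpZ // /= -rmodpB // PhiB -/(q k.+1) e exprS -!mul_polyC.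
  by congr rmodp; rewrite polyCM -/T; ring.
have [l lim] := adic_poly_limit q_size q_step.
pose ev : {rmorphism {poly R} -> K} :=
  [the {rmorphism _ -> _} of horner_eval s \o map_poly g].
have evS r : ev r \in S.
  apply/asboolP/integral_horner; last exact/asboolP.
  by apply/integral_poly => i; rewrite coef_map; exact: integral_id.
have evX : ev 'X = s by rewrite /ev /= map_polyX /horner_eval hornerX.
have evC c : ev c%:P = g c by rewrite /ev /= map_polyC /horner_eval hornerC.
have evmod r : ev (rmodp r p) = ev r.
  rewrite {2}(rdivp_eq p_monic r) rmorphD rmorphM.
  by rewrite [ev p]ps0 mulr0 add0r.
have fixl : ev (l - Phi l) = 0.
  apply: integral_separated => k.
  have [d e] := lim k.+1; have [d' e'] := lim k.
  exists (ev (t *: d - T * d' * Psi (q k) l)); first exact: evS.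
  have -> : g t ^+ k = ev (t ^+ k)%:P by rewrite evC rmorphXn.
  have -> : l - Phi l = (l - q k.+1) + (rmodp (Phi (q k)) p - Phi (q k))
      + (Phi (q k) - Phi l) by rewrite /=; ring.
  rewrite e PhiB rmorphD [ev (_ + _)]rmorphD [ev (rmodp _ _ - _)]rmorphB evmod.
  rewrite subrr addr0 -[LHS]rmorphD -[RHS]rmorphM; apply: (congr1 ev).
  rewrite -(opprB l) e' exprS -!mul_polyC polyCM -/T; ring.
exists (1 + g t * ev l).
  by rewrite rpredD ?rpredM ?rpred1 ?integral_mem ?evS.
have : ev (2 * (l - Phi l)) = 0 by rewrite rmorphM fixl mulr0.
have -> : 2 * (l - Phi l) =
    2 * l + ('X + T * (2 * 'X * l + l ^+ 2 + T * 'X * l ^+ 2)).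
  rewrite /Phi mulrBr mulNr mulrN opprK; congr (_ + _).
  by rewrite mulrA h2 mul1r.
rewrite !(rmorphD, rmorphM, rmorphXn) evX => e.
apply/eqP; rewrite -subr_eq0; apply/eqP; rewrite -[RHS](mulr0 (g t)) -[in RHS]e.
by rewrite (evC t) rmorph1; ring.
Qed.

End Hensel.

Section CompleteValuation.
Variables (R : idomainType) (t : R).
Hypotheses (R_complete : complete_dvr R) (tP : uniformizer t).
Variables (F : fieldType) (iota : {rmorphism R -> F}).
Hypothesis iota_inj : injective iota.
Hypothesis iota_frac : forall x, exists a b, b != 0 /\ x = iota a / iota b.
Local Notation SF := (integral_pred iota).

Let dvr := R_complete.1.
Let tN := uniformizer_nonunit tP.
Let t0 := uniformizer_neq0 tP.

Let it0 : iota t != 0.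
Proof. by rewrite -(rmorph0 iota) (inj_eq iota_inj). Qed.

Lemma frac_uniformizer (x : F) : x != 0 ->
  (exists n u, u \is a GRing.unit /\ x = iota (u * t ^+ n)) \/
  (exists n u, u \is a GRing.unit /\ x^-1 = iota (u * t ^+ n.+1)).
Proof.
have [a [b [b0 ->]]] := iota_frac x => ab0.
apply: ratio_uniformizer => //.
by apply: contraNneq ab0 => ->; rewrite rmorph0 mul0r.
Qed.

Lemma frac_clear_denominator (x : F) : exists m, iota t ^+ m * x \in SF.
Proof.
have [->|x0] := eqVneq x 0; first by exists 0%N; rewrite mulr0 rpred0.
have [[n [u [uu ->]]]|[n [u [uu xV]]]] := frac_uniformizer x0.
  by exists 0%N; rewrite mul1r integral_mem.
exists n.+1; rewrite -[x]invrK xV rmorphM rmorphXn invfM mulrC mulfVK ?expf_neq0 //.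
by rewrite -rmorphV // integral_mem.
Qed.

Lemma frac_inv_nonunit : (iota t)^-1 \notin SF.
Proof. exact: integral_inv_nonunit iota_inj. Qed.

(** The valuation ring property, with the elements outside [R] having their inverse
    in the maximal ideal. *)
Lemma frac_valuation (x : F) :
  x \in SF \/ exists2 y, y \in SF & x * (iota t * y) = 1.
Proof.
have [->|x0] := eqVneq x 0; first by left; rewrite rpred0.
have [[n [u [uu ->]]]|[n [u [uu xV]]]] := frac_uniformizer x0.
  by left; rewrite integral_mem.
right; exists (iota (u * t ^+ n)); first exact: integral_mem.
by rewrite -rmorphM mulrCA -exprS -xV divff.
Qed.

(** Valuation rings are integrally closed. *)
Lemma frac_integral (x : F) : x \in SF -> exists r, x = iota r.
Proof.
move=> xS; have [->|x0] := eqVneq x 0; first by exists 0; rewrite rmorph0.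
have [[n [u [uu ->]]]|[n [u [uu xV]]]] := frac_uniformizer x0.
  by exists (u * t ^+ n).
have /negP[] := frac_inv_nonunit.
suff -> : (iota t)^-1 = x * iota (u * t ^+ n) by rewrite rpredM ?integral_mem.
apply: (mulIf it0); rewrite mulVf // -mulrA -rmorphM -mulrA -exprSr -xV.
by rewrite divff.
Qed.

Variable E : fieldExtType F.
Local Notation iotaE := [the {rmorphism R -> E} of in_alg E \o iota].
Local Notation SE := (integral_pred iotaE).

Lemma frac_ext_integral (x : F) : x \in SF -> x%:A \in SE.
Proof. by move=> /frac_integral[r ->]; exact: (integral_mem iotaE). Qed.

Lemma iotaE_inj : injective iotaE.
Proof. by move=> a b /= /(fmorph_inj (in_alg E)) /iota_inj. Qed.

(** [x^-1] is a polynomial in [x] over [F], and a power of [t] clears the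
    denominators of its coefficients. *)
Lemma ext_integral_sep (x : E) : x \in SE -> x != 0 ->
  exists m, iotaE t ^+ m / x \in SE.
Proof.
move=> xS x0.
have : x^-1 \in <<1; x>>%VS by rewrite memvV memv_adjoin.
move=> /Fadjoin1_polyP[p px].
have clear (s : seq F) : exists m, {in s, forall c, iota t ^+ m * c \in SF}.
  elim: s => [|c s [m IH]]; first by exists 0%N.
  have [n nc] := frac_clear_denominator c.
  exists (m + n)%N => d; rewrite in_cons => /orP[/eqP->|/IH ds].
    by rewrite exprD -mulrA rpredM // rpredX // integral_mem.
  by rewrite addnC exprD -mulrA rpredM // rpredX // integral_mem.
have [m mp] := clear p.
exists m; rewrite px -hornerZ.
apply/asboolP/integral_horner; last exact/asboolP.
apply/integral_poly => i; rewrite coefZ coef_map.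
have [lt_ip|le_pi] := ltnP i (size p); last first.
  by rewrite nth_default //= scale0r mulr0; exact: integral0.
have := frac_ext_integral (mp _ (mem_nth 0 lt_ip)).
by move=> /asboolP; rewrite -in_algE rmorphM rmorphXn.
Qed.

Hypothesis unit2 : (2 : R) \is a GRing.unit.

Lemma frac_inv_sqrt s : s \in SF ->
  exists2 d, d \in SF & d ^+ 2 * (1 + iota t * s) = 1.
Proof.
apply: (integral_inv_sqrt (R_complete.2 t tP) tN t0 iota_inj) => // x _ _.
exact: frac_clear_denominator.
Qed.

Lemma ext_inv_sqrt s : s \in SE ->
  exists2 d, d \in SE & d ^+ 2 * (1 + iotaE t * s) = 1.
Proof.
exact: (integral_inv_sqrt (R_complete.2 t tP) tN t0 iotaE_inj ext_integral_sep).
Qed.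

End CompleteValuation.

(** * Springer's theorem for isotropy *)

Section QuadForm.
Variable N : nat.

Definition quad (K : comNzRingType) (G : 'M[K]_N) (x : 'rV[K]_N) : K :=
  \sum_i \sum_j G i j * (x 0 i * x 0 j).

Lemma quad_scale (K : comNzRingType) (G : 'M[K]_N) a x :
  quad G (a *: x) = a ^+ 2 * quad G x.
Proof.
rewrite mulr_sumr; apply: eq_bigr => i _; rewrite mulr_sumr.
by apply: eq_bigr => j _; rewrite !mxE; ring.
Qed.

Lemma quad_map (K L : comNzRingType) (f : {rmorphism K -> L}) (G : 'M[K]_N) x :
  quad (map_mx f G) (map_mx f x) = f (quad G x).
Proof.
rewrite rmorph_sum; apply: eq_bigr => i _; rewrite rmorph_sum.
by apply: eq_bigr => j _; rewrite !mxE !rmorphM.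
Qed.

Section Poly.
Variables (F : fieldType) (G : 'M[F]_N).
Local Notation GP := (map_mx polyC G).

Lemma quad_dvdp (f : {poly F}) (g h : 'rV[{poly F}]_N) :
  (forall k, f %| g 0 k - h 0 k) -> f %| quad GP g -> f %| quad GP h.
Proof.
move=> gh; suff gh_f : f %| quad GP g - quad GP h.
  by move=> /dvdp_sub/(_ gh_f); rewrite subKr.
rewrite -sumrB; apply: (big_ind (fun p => f %| p)) => [||i _].
- exact: dvdp0.
- exact: dvdp_add.
rewrite -sumrB; apply: (big_ind (fun p => f %| p)) => [||j _].
- exact: dvdp0.
- exact: dvdp_add.
rewrite -mulrBr dvdp_mull //.
have -> : g 0 i * g 0 j - h 0 i * h 0 j
   = g 0 j * (g 0 i - h 0 i) + h 0 i * (g 0 j - h 0 j) by ring.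
by rewrite dvdp_add // dvdp_mull.
Qed.

Lemma coefM_top m (p r : {poly F}) : (size p <= m.+1)%N -> (size r <= m.+1)%N ->
  (p * r)`_(m + m) = p`_m * r`_m.
Proof.
move=> sp sr; rewrite coefM.
have lt_m : (m < (m + m).+1)%N by lia.
rewrite (bigD1 (Ordinal lt_m)) //= addnK big1 ?addr0 // => i.
rewrite -val_eqE /= => im; have [lt_im|le_mi] := ltnP i m.
  by rewrite [r`__]nth_default ?mulr0 // (leq_trans sr) //; lia.
by rewrite nth_default ?mul0r // (leq_trans sp) // ltn_neqAle eq_sym im.
Qed.

Lemma quad_coef m (g : 'rV[{poly F}]_N) : (forall k, size (g 0%R k) <= m.+1)%N ->
  (quad GP g)`_(m + m) = quad G (\row_k (g 0 k)`_m).
Proof.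
move=> sg; rewrite coef_sum; apply: eq_bigr => i _; rewrite coef_sum.
by apply: eq_bigr => j _; rewrite !mxE coefCM coefM_top.
Qed.

Lemma size_quad m (g : 'rV[{poly F}]_N) : (forall k, size (g 0%R k) <= m.+1)%N ->
  (size (quad GP g) <= (m + m).+1)%N.
Proof.
move=> sg; apply: (leq_trans (size_sum _ _ _)); apply/bigmax_leqP => i _.
apply: (leq_trans (size_sum _ _ _)); apply/bigmax_leqP => j _.
rewrite mxE mul_polyC; apply: (leq_trans (size_scale_leq _ _)).
apply: (leq_trans (size_polyMleq _ _)); have := leq_add (sg i) (sg j).
by rewrite addSn addnS; case: (_ + _)%N.
Qed.

Lemma dvdp_biggcd (e : {poly F}) (I : Type) (s : seq I) (h : I -> {poly F}) :
  (e %| \big[@gcdp F/0]_(k <- s) h k) = all (fun k => e %| h k) s.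
Proof.
elim: s => [|k s IH]; first by rewrite big_nil dvdp0.
by rewrite big_cons dvdp_gcd IH.
Qed.

(** Springer's argument, with divisibility by [f] in place of a root in an
    extension; the induction can then go on with an [h] that is not irreducible.
    Reduce [g] modulo [f] and divide by the content: the result [s] has degree
    [m < deg f] and a nonzero vector [c] of coefficients in degree [m].  Unless [c]
    is isotropic, [quad GP s] has degree exactly [2 * m], so its cofactor [h] has
    odd degree less than [deg f], and [h] divides [quad GP s] too. *)
Lemma springer_poly n (f : {poly F}) (g : 'rV[{poly F}]_N) : (size f <= n)%N ->
    f != 0 -> ~~ odd (size f) ->
    (forall d, d %| f -> (forall k, d %| g 0 k) -> size d = 1%N) ->
    f %| quad GP g ->
  exists2 x : 'rV[F]_N, x != 0 & quad G x = 0.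
Proof.
elim: n f g => [|n IH] f g; first by rewrite leqn0 size_poly_eq0 => /eqP-> /eqP.
move=> sf f0 f_odd fg_coprime f_dvd.
pose r : 'rV[{poly F}]_N := \row_k (g 0 k %% f).
have gr k : f %| g 0 k - r 0 k.
  by rewrite mxE {1}(divp_eq (g 0 k) f) addrK dvdp_mull.
have fr : f %| quad GP r by exact: quad_dvdp f_dvd.
pose d := \big[@gcdp F/0]_(k <- index_enum 'I_N) r 0 k.
have dP e : (e %| d) = [forall k, e %| r 0 k].
  rewrite dvdp_biggcd; apply/allP/forallP => [h k|h k _]; last exact: h.
  by apply: h; rewrite mem_index_enum.
have d_dvd k : d %| r 0 k by move: (dvdpp d); rewrite dP => /forallP.
have d0 : d != 0.
  apply: contraNneq f_odd => d0; rewrite (fg_coprime f) // => k.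
  have := d_dvd k; rewrite d0 dvd0p => /eqP rk0.
  by have := gr k; rewrite rk0 subr0.
have fd : coprimep f d.
  apply/eqP/fg_coprime; first exact: dvdp_gcdl.
  move=> k; rewrite -(subrK (r 0 k) (g 0 k)).
  apply: dvdp_add; first exact: dvdp_trans (dvdp_gcdl _ _) (gr k).
  exact: dvdp_trans (dvdp_gcdr _ _) (d_dvd k).
pose s : 'rV[{poly F}]_N := \row_k (r 0 k %/ d).
have rs : r = d *: s.
  by apply/rowP => k; rewrite [RHS]mxE [s _ _]mxE mulrC divpK.
have rsk k : r 0 k = d * s 0 k by rewrite {1}rs [LHS]mxE.
have fs : f %| quad GP s.
  move: fr; rewrite rs quad_scale Gauss_dvdpr //.
  by rewrite expr2 coprimepMr fd.
pose m := (\max_k size (s 0%R k)).-1%N.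
have [k0 sk0] : exists k, s 0 k != 0.
  apply/existsP; apply: contraNT d0 => /existsPn s0; move: (dP 0).
  rewrite dvd0p => ->; apply/forallP => k; rewrite dvd0p rsk.
  by have /negPn/eqP-> := s0 k; rewrite mulr0.
have mE : (\max_k size (s 0%R k))%N = m.+1.
  rewrite /m prednK //; apply: (@leq_trans (size (s 0%R k0))).
    by rewrite size_poly_gt0.
  exact: leq_bigmax.
have s_size k : (size (s 0%R k) <= m.+1)%N by rewrite -mE; exact: leq_bigmax.
have [k1 k1m] : exists k, size (s 0%R k) = m.+1.
  rewrite -mE; have [|k _ ->] := @eq_bigmax_cond 'I_N predT (fun k => size (s 0%R k)).
    by apply/card_gt0P; exists k0.
  by exists k.
have lt_mf : (m.+1 < size f)%N.
  rewrite -k1m; apply: (@leq_ltn_trans (size (r 0%R k1))).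
    rewrite rsk size_mul //; last by rewrite -size_poly_gt0 k1m.
    by move: d0; rewrite -size_poly_gt0; case: (size d) => // *; rewrite leq_addl.
  by rewrite mxE ltn_modp.
pose c : 'rV[F]_N := \row_k (s 0 k)`_m.
have c0 : c != 0.
  apply/rV0Pn; exists k1; rewrite mxE.
  have -> : m = (size (s 0%R k1)).-1 by rewrite k1m.
  by rewrite -lead_coefE lead_coef_eq0 -size_poly_gt0 k1m.
have [qc0|qc0] := eqVneq (quad G c) 0; first by exists c.
have qs_size : size (quad GP s) = (m + m).+1.
  apply/eqP; rewrite eqn_leq size_quad //= ltnNge; apply: contra qc0 => le.
  by rewrite -quad_coef // nth_default.
have qs0 : quad GP s != 0 by rewrite -size_poly_gt0 qs_size.
have [h qsh] := dvdpP _ _ fs.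
have h0 : h != 0 by apply: contraNneq qs0 => h0; rewrite qsh h0 mul0r.
have h_size : (size h + size f = (m + m).+2)%N.
  move: qs_size; rewrite qsh size_mul // => <-; rewrite prednK //.
  by rewrite addn_gt0 size_poly_gt0 h0.
have [h_le h_odd] : (size h <= n)%N /\ ~~ odd (size h).
  by move: (size h) (size f) sf f_odd lt_mf h_size; clear; lia.
apply: (IH h s) => //.
- move=> e eh es; apply/eqP; rewrite -dvdp1.
  rewrite -(dvdp_mul2r _ _ d0) mul1r dP; apply/forallP => k.
  by rewrite rsk mulrC dvdp_mul.
by rewrite qsh dvdp_mulr.
Qed.

End Poly.
End QuadForm.

Section SpringerTower.
Variables (F : fieldType) (E : fieldExtType F) (N : nat) (G : 'M[F]_N).
Local Notation GE := (map_mx (in_alg E) G).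

Lemma springer_adjoin (K : {subfield E}) (a : E) (x : 'rV[E]_N) :
    odd (adjoin_degree K a) ->
    (forall k, x 0 k \in <<K; a>>%VS) -> x != 0 -> quad GE x = 0 ->
  exists y : 'rV[E]_N, [/\ forall k, y 0 k \in K, y != 0 & quad GE y = 0].
Proof.
move=> a_odd xKa x0 qx.
have [f fE] := polyOver_subvs (minPolyOver K a).
have f_size : size f = (adjoin_degree K a).+1.
  by rewrite -(size_minPoly K a) fE size_map_poly.
have f0 : f != 0 by rewrite -size_poly_gt0 f_size.
have lift k : exists g : {poly subvs_of K},
    Fadjoin_poly K a (x 0 k) = map_poly vsval g.
  exact/polyOver_subvs/Fadjoin_polyOver.
pose g : 'rV[{poly subvs_of K}]_N := \row_k sval (cid (lift k)).
have gE k : map_poly vsval (g 0 k) = Fadjoin_poly K a (x 0 k).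
  by rewrite mxE; case: cid.
pose ev : {rmorphism {poly subvs_of K} -> E} :=
  [the {rmorphism _ -> _} of horner_eval a \o map_poly vsval].
have evg k : ev (g 0 k) = x 0 k.
  by rewrite /ev /= gE /horner_eval Fadjoin_poly_eq.
have vsvalA (c : F) : vsval (c%:A : subvs_of K) = c%:A.
  by rewrite linearZ /= algid1.
pose GK := map_mx (in_alg (subvs_of K)) G.
have [|||y y0 qy] := @springer_poly N _ GK _ f g (leqnn _) f0.
- by rewrite f_size /= negbK.
- move=> d df dg.
  (* A common divisor of [f] and [g] is a unit or [f] itself, and the entries of
     [g] are too small for the latter. *)
  have : map_poly vsval d %| minPoly K a by rewrite fE dvdp_map.
  have /minPoly_irr/[apply] : map_poly vsval d \is a polyOver K.
    by apply/polyOver_subvs; exists d.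
  rewrite fE eqp_map -size_poly_eq1 size_map_poly => /orP[fd|/eqP//].
    case/negP: x0; apply/eqP/rowP => k; rewrite mxE -evg.
    suff -> : g 0 k = 0 by rewrite rmorph0.
    apply/eqP; apply: contraT => gk0.
    have : f %| g 0 k by rewrite -(eqp_dvdl _ fd).
    move/(dvdp_leq gk0); rewrite f_size -(size_map_poly vsval) gE.
    by rewrite ltnNge size_Fadjoin_poly.
- rewrite -(dvdp_map vsval) -fE; apply: minPoly_dvdp.
    by apply/polyOver_subvs; exists (quad (map_mx polyC GK) g).
  apply/rootP; rewrite -[LHS]/(ev _) -quad_map -qx; congr quad.
    apply/matrixP => i j; rewrite !mxE /ev /= map_polyC /horner_eval hornerC.
    exact: vsvalA.
  by apply/rowP => k; rewrite mxE evg.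
exists (map_mx vsval y); split.
- by move=> k; rewrite mxE; exact: subvsP.
- by rewrite map_mx_eq0.
have -> : GE = map_mx vsval GK.
  by apply/matrixP => i j; rewrite !mxE; exact/esym/vsvalA.
by rewrite quad_map qy rmorph0.
Qed.

(** The coordinates of [x] are adjoined one by one, since an inseparable extension
    need not have a primitive element. *)
Lemma springer_isotropic (x : 'rV[E]_N) : odd (\dim {:E}) ->
  x != 0 -> quad GE x = 0 -> exists2 y : 'rV[F]_N, y != 0 & quad G y = 0.
Proof.
move=> E_odd; pose s := [seq x 0 k | k <- enum 'I_N].
have xs k : x 0 k \in <<1 & s>>%VS.
  by apply: seqv_sub_adjoin; apply: map_f; rewrite mem_enum.
move: s xs => s; elim/last_ind: s x => [|s a IH] x xs x0 qx.
  have lift k : exists c : F, x 0 k = c%:A.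
    by have := xs k; rewrite Fadjoin_nil => /vlineP.
  pose y : 'rV[F]_N := \row_k sval (cid (lift k)).
  have xy : x = map_mx (in_alg E) y.
    by apply/rowP => k; rewrite !mxE; case: cid => c.
  exists y; first by move: x0; rewrite xy map_mx_eq0.
  by apply/eqP; rewrite -(fmorph_eq0 (in_alg E)) -quad_map -xy qx.
have [||y [ys y0 qy]] := @springer_adjoin <<1 & s>>%AS a x _ _ x0 qx.
- have : odd (\dim <<1 & rcons s a>>) by apply: dvdn_odd (field_dimS (subvf _)) E_odd.
  by rewrite adjoin_rcons dim_Fadjoin oddM => /andP[].
- by move=> k; rewrite -adjoin_rcons.
exact: IH y ys y0 qy.
Qed.

End SpringerTower.

Lemma quadE (K : comNzRingType) N (G : 'M[K]_N) (x : 'rV[K]_N) :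
  quad G x = (x *m G *m x^T) 0 0.
Proof.
rewrite mxE /quad exchange_big; apply: eq_bigr => j _; rewrite !mxE mulr_suml.
by apply: eq_bigr => i _; rewrite /=; ring.
Qed.

(** The rows of [P] span a subspace; adding a coordinate [s] of norm [- b] makes the
    representation of [b] on that subspace a question of isotropy. *)
Lemma quad_subspace (F : fieldType) d m (P : 'M[F]_(d, m)) (G : 'M[F]_m) (b : F)
    (K : comNzRingType) (f : {rmorphism F -> K}) u (s : K) :
  quad (map_mx f (block_mx (P *m G *m P^T) 0 0 (- b%:M : 'M_1))) (row_mx u s%:M) =
    quad (map_mx f G) (u *m map_mx f P) - f b * s ^+ 2.
Proof.
rewrite !quadE map_block_mx tr_row_mx mul_row_block mul_row_col.
rewrite !map_mx0 !mulmx0 addr0 add0r [LHS]mxE trmx_mul !map_mxM map_trmx !mulmxA.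
congr (_ + _); rewrite map_mxN map_scalar_mx mulmxN -scalar_mxM tr_scalar_mx.
by rewrite mulNmx -scalar_mxM !mxE eqxx mulr1n; ring.
Qed.

(** The pair [(x, 1)] is isotropic for [quad G - b s ^+ 2] on the subspace cut out by
    [C].  Springer's theorem yields a pair [(v, c)] over [F], in which [v] is not
    [0] because [b] is not. *)
Lemma springer_represent (F : fieldType) (E : fieldExtType F) m r
    (G : 'M[F]_m) (C : 'M[F]_(m, r)) (b : F) (x : 'rV[E]_m) :
    odd (\dim {:E}) -> b != 0 -> x *m map_mx (in_alg E) C = 0 ->
    quad (map_mx (in_alg E) G) x = b%:A ->
  exists v : 'rV[F]_m, [/\ v != 0, v *m C = 0 & exists c, quad G v = b * c ^+ 2].
Proof.
move=> E_odd b0 xC qx; pose phi := in_alg E.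
pose P := row_base (kermx C).
have : (x <= map_mx phi P)%MS.
  have xK : (x <= map_mx phi (kermx C))%MS.
    by rewrite map_kermx; apply/sub_kermxP.
  by apply: submx_trans xK _; rewrite map_submx eq_row_base.
move=> /submxP[y xy].
pose H := block_mx (P *m G *m P^T) 0 0 (- b%:M : 'M_1).
have quadH := quad_subspace P G b.
have [||w w0 qw] := @springer_isotropic F E _ H (row_mx y 1%:M) E_odd.
- rewrite -row_mx0; apply/eqP => /eq_row_mx[_ /matrixP/(_ 0 0)].
  by rewrite !mxE eqxx => /eqP; rewrite oner_eq0.
- by rewrite (quadH _ phi) -xy qx expr1n mulr1 subrr.
rewrite -(hsubmxK w) in w0 qw.
have sE : rsubmx w = (rsubmx w 0 0)%:M by exact: mx11_scalar.
set u := lsubmx w in w0 qw; set s := rsubmx w 0 0 in sE.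
rewrite sE in w0 qw.
have := quadH F idfun u s; rewrite !map_mx_id // qw => /esym/eqP.
rewrite subr_eq0 => /eqP qv.
exists (u *m P); split; last by exists s.
  apply: contraNneq w0 => v0.
  have u0 : u = 0.
    by apply: (row_free_inj (row_base_free (kermx C))); rewrite mul0mx.
  move: qv; rewrite v0 u0 quadE mul0mx mul0mx mxE => /eqP.
  rewrite eq_sym mulf_eq0 (negPf b0) expf_eq0 /= => /eqP ->.
  by rewrite raddf0 row_mx0.
apply/sub_kermxP; apply: (submx_trans (submxMl _ _)).
by rewrite eq_row_base.
Qed.

(** * Orthogonal systems over a field *)

Section SymmetricBilinear.
Variables (K : fieldType) (V : lmodType K) (B : V -> V -> K).
Hypothesis B_sym : forall u v, B u v = B v u.
Hypothesis B_lin : forall a u v w, B (a *: u + v) w = a * B u w + B v w.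

Definition ortho_system (b : nat -> K) j (z : nat -> V) :=
  forall p q, (p < j)%N -> (q < j)%N -> B (z p) (z q) = b p *+ (p == q).

Let BZl a u w : B (a *: u) w = a * B u w.
Proof.
have B0 : B 0 w = 0.
  apply: (addrI (B 0 w)); rewrite addr0 -{3}(addr0 (0 : V)) -{3}(scale1r 0).
  by rewrite B_lin mul1r.
by rewrite -[a *: u]addr0 B_lin B0 addr0.
Qed.

Let BZr a u w : B w (a *: u) = a * B w u.
Proof. by rewrite B_sym BZl B_sym. Qed.

Let BDr a u v w : B w (a *: u + v) = a * B w u + B w v.
Proof. by rewrite B_sym B_lin !(B_sym w). Qed.

Definition reflection (u v : V) : V := (- (2 * B v u / B u u)) *: u + v.

Lemma reflection_isometry u v w : B u u != 0 ->
  B (reflection u v) (reflection u w) = B v w.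
Proof.
move=> u0; rewrite /reflection !(B_lin, BDr) (B_sym u w); field; exact: u0.
Qed.

Lemma reflection_fix u v : B v u = 0 -> reflection u v = v.
Proof. by move=> vu; rewrite /reflection vu mulr0 mul0r oppr0 scale0r add0r. Qed.

Hypothesis two_neq0 : 2 != 0 :> K.

(** [B (x - y) (x - y)] and [B (x + y) (x + y)] add up to [4 * B x x], so one of
    the two vectors is anisotropic; the reflection along it maps [x] to [y] or
    to [- y]. *)
Lemma isometry_move x y : B x x = B y y -> B x x != 0 ->
  exists s : V -> V, [/\ forall u v, B (s u) (s v) = B u v, s x = y &
    forall u, B u x = 0 -> B u y = 0 -> s u = u].
Proof.
move=> xy x0.
pose d := (-1) *: y + x; pose e := 1 *: y + x.
have dd : B d d = 2 * (B x x - B x y).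
  by rewrite /d !(B_lin, BDr) (B_sym y x) -xy; ring.
have ee : B e e = 2 * (B x x + B x y).
  by rewrite /e !(B_lin, BDr) (B_sym y x) -xy; ring.
have [d0|d0] := eqVneq (B d d) 0; last first.
  exists (reflection d); split=> [u v||u ux uy]; first exact: reflection_isometry.
    have c : B x x - B x y != 0 by apply: contraNneq d0 => c; rewrite dd c mulr0.
    rewrite /reflection dd [B x d]BDr.
    have -> : - (2 * (-1 * B x y + B x x) / (2 * (B x x - B x y))) = - 1.
      by field; rewrite c two_neq0.
    by rewrite scaleN1r /d scaleN1r opprD opprK subrK.
  by apply: reflection_fix; rewrite BDr ux uy mulr0 addr0.
have e0 : B e e != 0.
  have -> : B e e = 4 * B x x - B d d by rewrite dd ee; ring.
  rewrite d0 subr0 mulf_neq0 //.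
  have -> : 4 = 2 * 2 :> K by ring.
  by rewrite mulf_neq0.
have y0 : B y y != 0 by rewrite -xy.
exists (reflection y \o reflection e); split=> [u v||u ux uy] /=.
- by rewrite !reflection_isometry.
- have c : B x x + B x y != 0 by apply: contraNneq e0 => c; rewrite ee c mulr0.
  have -> : reflection e x = - y.
    rewrite /reflection ee [B x e]BDr.
    have -> : - (2 * (1 * B x y + B x x) / (2 * (B x x + B x y))) = - 1.
      by field; rewrite c two_neq0.
    by rewrite scaleN1r /e scale1r opprD subrK.
  rewrite /reflection -scaleN1r BZl.
  have -> : - (2 * (-1 * B y y) / B y y) = 2 by field.
  rewrite -scalerDl; have -> : 2 + -1 = 1 :> K by ring.
  by rewrite scale1r.
by rewrite !reflection_fix // BDr ux uy mulr0 addr0.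
Qed.

(** Witt's cancellation theorem for orthogonal systems.  The form may be degenerate
    as long as the vectors of the systems are anisotropic. *)
Lemma witt_complement b j y w : ortho_system b j y -> ortho_system b j.+1 w ->
  (forall p, (p <= j)%N -> b p != 0) ->
  exists x, B x x = b j /\ forall p, (p < j)%N -> B x (y p) = 0.
Proof.
move=> yO wO b0.
have move i : (i <= j)%N ->
    exists w', ortho_system b j.+1 w' /\ forall p, (p < i)%N -> w' p = y p.
  elim: i => [_|i IH lt_ij]; first by exists w.
  have [w' [w'O w'y]] := IH (ltnW lt_ij).
  have lt_iSj : (i < j.+1)%N by exact: ltnW.
  have [||s [s_iso s_move s_fix]] := @isometry_move (w' i) (y i).
  - by rewrite w'O // yO.
  - by rewrite w'O // eqxx b0 // ltnW.
  exists (s \o w'); split=> [p q pj qj|p]; first by rewrite /= s_iso w'O.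
  rewrite ltnS leq_eqVlt => /orP[/eqP->|lt_pi]; first exact: s_move.
  have lt_pj := ltn_trans lt_pi lt_ij.
  rewrite /= s_fix; first exact: w'y.
  - by rewrite w'O ?(ltn_eqF lt_pi) // ltnW.
  - by rewrite w'y // yO // (ltn_eqF lt_pi).
have [x [xO xy]] := move j (leqnn j).
exists (x j); split; first by rewrite xO // eqxx.
move=> p lt_pj; rewrite -xy // xO //; last exact: ltnW.
by rewrite eq_sym (ltn_eqF lt_pj).
Qed.

Variables (S : subringClosed K) (t : K).
Hypothesis tS : t \in S.
Hypothesis S_inv_sqrt : forall s, s \in S ->
  exists2 d, d \in S & d ^+ 2 * (1 + t * s) = 1.

(** The Gram-Schmidt process keeps errors in [t * beta * S]: all norms [b p] divide
    [beta], so that a norm is off by a factor [1 + t * s], which is a square, and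
    the projections onto a corrected vector have coefficients in [t * S]. *)
Lemma normalize_system b beta j z : (forall p, (p < j)%N -> b p != 0) ->
  (forall p, (p < j)%N -> beta / b p \in S) ->
  (forall p q, (p < j)%N -> (q < j)%N ->
     exists2 s, s \in S & B (z p) (z q) = b p *+ (p == q) + t * beta * s) ->
  exists w, ortho_system b j w.
Proof.
move=> b0 bS zO.
pose near (w : nat -> V) p q :=
  exists2 s, s \in S & B (w p) (w q) = b p *+ (p == q) + t * beta * s.
have step i : (i <= j)%N -> exists w : nat -> V,
    (forall p q, (p < j)%N -> (q < j)%N -> near w p q) /\
    (forall p q, (p < i)%N -> (q < j)%N -> B (w p) (w q) = b p *+ (p == q)).
  elim: i => [_|i IH lt_ij]; first by exists z.
  have [w [w_near w_exact]] := IH (ltnW lt_ij).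
  have bi0 := b0 _ lt_ij.
  have [s sS] := w_near i i lt_ij lt_ij; rewrite eqxx mulr1n => wi.
  have [d dS d1] := S_inv_sqrt (rpredM (bS _ lt_ij) sS).
  pose u := d *: w i.
  have uu : B u u = b i.
    rewrite /u BZl BZr wi mulrA -expr2 -[RHS]mul1r -d1; field; exact: bi0.
  pose w' p := if (p < i)%N then w p else if p == i then u
    else (- (B (w p) u / b i)) *: u + w p.
  have exact_lt p q : (p < i)%N -> (q < j)%N -> B (w' p) (w' q) = b p *+ (p == q).
    move=> lt_pi lt_qj; rewrite /w' lt_pi.
    have pu : B (w p) u = 0.
      by rewrite /u BZr w_exact // (ltn_eqF lt_pi) mulr0.
    case: ltnP => [_|le_iq]; first exact: w_exact.
    have [->|_] := eqVneq q i; first by rewrite pu (ltn_eqF lt_pi).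
    by rewrite BDr pu mulr0 add0r w_exact.
  have exact_i q : (q < j)%N -> B (w' i) (w' q) = b i *+ (i == q).
    move=> lt_qj; case: (ltnP q i) => [lt_qi|le_iq].
      rewrite B_sym exact_lt // (ltn_eqF lt_qi) eq_sym (ltn_eqF lt_qi).
      by [].
    rewrite /w' ltnn eqxx ltnNge le_iq /=.
    have [_|_] := eqVneq q i; first by rewrite uu.
    rewrite BDr uu (B_sym u) mulr0n; field; exact: bi0.
  exists w'; split=> p q; last first.
    rewrite ltnS leq_eqVlt => /orP[/eqP->|]; [exact: exact_i|exact: exact_lt].
  move=> lt_pj lt_qj.
  have exactN x : x = b p *+ (p == q) ->
      exists2 s, s \in S & x = b p *+ (p == q) + t * beta * s.
    by move=> ->; exists 0; rewrite ?rpred0 // mulr0 addr0.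
  case: (ltngtP p i) => [lt_pi|lt_ip|pi]; last 1 first.
  - by apply: exactN; rewrite pi exact_i.
  - by apply: exactN; exact: exact_lt.
  case: (ltngtP q i) => [lt_qi|lt_iq|qi]; last 1 first.
  - apply: exactN; rewrite B_sym qi exact_i // -qi.
    by rewrite eq_sym; case: eqP => [->|].
  - apply: exactN; rewrite B_sym exact_lt //.
    by rewrite eq_sym; case: eqP => [->|].
  rewrite /near /w' !ltnNge !(ltnW lt_ip, ltnW lt_iq) /=.
  rewrite (gtn_eqF lt_ip) (gtn_eqF lt_iq).
  have [sp spS wp] := w_near p i lt_pj lt_ij.
  have [sq sqS wq] := w_near q i lt_qj lt_ij.
  rewrite (gtn_eqF lt_ip) mulr0n add0r in wp.
  rewrite (gtn_eqF lt_iq) mulr0n add0r in wq.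
  have [r rS wpq] := w_near p q lt_pj lt_qj.
  exists (r - t * (beta / b i) * d ^+ 2 * sp * sq).
    by rewrite rpredB // 3?rpredM // ?rpredX // rpredM // bS.
  rewrite !(B_lin, BDr) uu (B_sym u) /u !BZr wp wq wpq; field; exact: bi0.
have [w [_ wO]] := step j (leqnn j).
by exists w.
Qed.

End SymmetricBilinear.

(** * Representing one more vector over a valuation ring *)

Definition dot (K : comNzRingType) m (a : 'I_m -> K) (u v : 'rV[K]_m) : K :=
  \sum_k a k * u 0 k * v 0 k.

Lemma dot_sym (K : comNzRingType) m (a : 'I_m -> K) u v : dot a u v = dot a v u.
Proof. by apply: eq_bigr => k _; rewrite mulrAC. Qed.

Lemma dot_lin (K : comNzRingType) m (a : 'I_m -> K) c u v w :
  dot a (c *: u + v) w = c * dot a u w + dot a v w.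
Proof.
rewrite mulr_sumr -big_split; apply: eq_bigr => k _; rewrite !mxE /=; ring.
Qed.

Lemma dot_linr (K : comNzRingType) m (a : 'I_m -> K) c u v w :
  dot a w (c *: u + v) = c * dot a w u + dot a w v.
Proof. by rewrite dot_sym dot_lin !(dot_sym _ w). Qed.

Lemma dot_suml (K : comNzRingType) m (a : 'I_m -> K) (I : finType) (c : I -> K)
    (y : I -> 'rV_m) w :
  dot a (\sum_p c p *: y p) w = \sum_p c p * dot a (y p) w.
Proof.
rewrite /dot.
under eq_bigr => k _ do rewrite summxE mulr_sumr mulr_suml.
rewrite exchange_big; apply: eq_bigr => p _; rewrite mulr_sumr.
by apply: eq_bigr => k _; rewrite mxE; ring.
Qed.

Lemma quad_diag (K : comNzRingType) m (a : 'I_m -> K) u :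
  quad (diag_mx (\row_k a k)) u = dot a u u.
Proof.
apply: eq_bigr => i _; rewrite (bigD1 i) //= big1 ?addr0 => [|j ji].
  by rewrite !mxE eqxx mulr1n mulrA.
by rewrite !mxE eq_sym (negPf ji) mulr0n mul0r.
Qed.

(** [S] is a valuation ring of [F] whose maximal ideal is generated by [t]: this is
    what [S_val] and [tN] say. *)
Section Valuation.
Variables (F : fieldType) (S : subringClosed F) (t : F).
Hypothesis tS : t \in S.
Hypothesis tN : t^-1 \notin S.
Hypothesis half : (2 : F)^-1 \in S.
Hypothesis two_neq0 : 2 != 0 :> F.
Hypothesis S_val : forall x, x \in S \/ exists2 y, y \in S & x * (t * y) = 1.
Hypothesis S_inv_sqrt : forall s, s \in S ->
  exists2 d, d \in S & d ^+ 2 * (1 + t * s) = 1.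

Let t0 : t != 0.
Proof. by apply: contraNneq tN => ->; rewrite invr0 rpred0. Qed.

Lemma least_valuation (I : eqType) (f : I -> F) (s : seq I) (i : I) :
  i \in s -> f i != 0 ->
  exists i0, [/\ i0 \in s, f i0 != 0 & {in s, forall k, f k / f i0 \in S}].
Proof.
elim: s i => [|i1 s IH] i; first by [].
have [s0|] := boolP (all (fun k => f k == 0) s).
  rewrite in_cons => /orP[/eqP->|/(allP s0)/eqP->]; last by rewrite eqxx.
  move=> f0; exists i1; split => //; first by rewrite mem_head.
  move=> k; rewrite in_cons => /orP[/eqP->|/(allP s0)/eqP->].
    by rewrite divff // rpred1.
  by rewrite mul0r rpred0.
rewrite -has_predC => /hasP[i2 i2s f2] _ _.
have [i0 [i0s f0 min0]] := IH i2 i2s f2.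
have [i1S|[y yS e]] := S_val (f i1 / f i0).
  exists i0; split => //; first by rewrite in_cons i0s orbT.
  by move=> k; rewrite in_cons => /orP[/eqP->|/min0].
have f1 : f i1 != 0.
  by apply/eqP => f1; move/eqP: e; rewrite f1 !mul0r eq_sym oner_eq0.
exists i1; split; rewrite ?mem_head // => k.
rewrite in_cons => /orP[/eqP->|/min0 kS]; first by rewrite divff // rpred1.
have -> : f k / f i1 = (f k / f i0) * (t * y).
  have -> : t * y = f i0 / f i1 by rewrite -[RHS]mulr1 -e; field; rewrite f0 f1.
  by field; rewrite f0 f1.
by rewrite rpredM // rpredM.
Qed.

(** The valuation ring is local, and [2] is a unit. *)
Lemma unit_or x y : x \in S -> y \in S -> x + y = 2 ->
  (exists2 i, i \in S & x * i = 1) \/ (exists2 i, i \in S & y * i = 1).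
Proof.
move=> xS yS xy2.
have [x0|x0] := eqVneq x 0.
  have -> : y = 2 by rewrite -xy2 x0 add0r.
  by right; exists 2^-1; rewrite ?divff.
have [y0|y0] := eqVneq y 0.
  have -> : x = 2 by rewrite -xy2 y0 addr0.
  by left; exists 2^-1; rewrite ?divff.
have [xV|[z zS xz]] := S_val x^-1; first by left; exists x^-1; rewrite ?divff.
have [yV|[w wS yw]] := S_val y^-1; first by right; exists y^-1; rewrite ?divff.
case/negP: tN; have -> : t^-1 = 2^-1 * (z + w).
  have xtz : x = t * z by rewrite -[LHS]mulr1 -xz mulVKf.
  have ytw : y = t * w by rewrite -[LHS]mulr1 -yw mulVKf.
  have -> : z + w = 2 / t by rewrite -xy2 xtz ytw; field.
  by rewrite mulKf.
by rewrite rpredM // rpredD.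
Qed.

(** The root is [- s / (1 + d)] for a square root [d] of the reduced discriminant
    [1 - t * r * s].  One of [1 + d] and [1 - d] is a unit, so [d] or [- d] will
    do. *)
Lemma quadratic_root r s : r \in S -> s \in S ->
  exists2 X, X \in S & t * r * X ^+ 2 + 2 * X + s = 0.
Proof.
move=> rS sS.
have trsS : - (r * s) \in S by rewrite rpredN rpredM.
have [e eS e1] := S_inv_sqrt trsS.
pose d := (1 + t * - (r * s)) * e.
have dS : d \in S by rewrite rpredM // rpredD ?rpred1 // rpredM.
have d2 : t * r * s = 1 - d ^+ 2.
  have -> : d ^+ 2 = (1 + t * - (r * s)) * (e ^+ 2 * (1 + t * - (r * s))).
    by rewrite /d; ring.
  by rewrite e1; ring.
have root d' i : d' ^+ 2 = d ^+ 2 -> (1 + d') * i = 1 ->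
    t * r * (- s * i) ^+ 2 + 2 * (- s * i) + s = 0.
  move=> dd' i1; rewrite -dd' in d2.
  have -> : t * r * (- s * i) ^+ 2 + 2 * (- s * i) + s =
    s * (t * r * s * i ^+ 2 - 2 * i + 1) by ring.
  have -> : t * r * s * i ^+ 2 = (1 - d') * i * ((1 + d') * i) by rewrite d2; ring.
  have -> : (1 - d') * i * ((1 + d') * i) - 2 * i + 1 =
    ((1 + d') * i - 1) * ((1 - d') * i - 1) by ring.
  by rewrite i1 subrr mul0r mulr0.
have [|||[i iS i1]|[i iS i1]] := @unit_or (1 + d) (1 - d).
- by rewrite rpredD ?rpred1.
- by rewrite rpredB ?rpred1.
- by ring.
- by exists (- s * i); [rewrite rpredM // rpredN | exact: root i1].
- exists (- s * i); first by rewrite rpredM // rpredN.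
  by apply: (root (- d)) => //; rewrite sqrrN.
Qed.

(** In this section [a] gives the norms of an orthogonal basis, [0] standing for the
    basis vectors that are left out. *)
Section Step.
Variables (m : nat) (a : 'I_m -> F) (b : nat -> F) (j : nat).
Variable y : nat -> 'rV[F]_m.
Hypothesis a_dvd : forall k, a k = 0 \/ a k != 0 /\ b j / a k \in S.
Hypothesis b0 : forall p, (p <= j)%N -> b p != 0.
Hypothesis b_dvd : forall p, (p <= j)%N -> b j / b p \in S.
Hypothesis yS : forall p k, (p < j)%N -> y p 0 k \in S.
Hypothesis y_supp : forall p k, (p < j)%N -> a k = 0 -> y p 0 k = 0.
Hypothesis y_ortho : ortho_system (dot a) b j y.

(** [f] below is [b j / a k0] times the basis vector number [k0], projected onto the
    complement of the [y p].  The factor makes it integral, as [b p] and [a k0]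
    divide [b j], and it ensures that [B f v = b j] and [b j] divides the norm of
    [f].  The wanted vector is [X *: v + f], where [X] is a root of
    [t * r * X ^+ 2 + 2 * X + (f 0 k0 - 1)]. *)
Lemma represent_primitive (v : 'rV[F]_m) k0 r :
    (forall k, v 0 k \in S) -> v 0 k0 = 1 -> (forall k, a k = 0 -> v 0 k = 0) ->
    (forall p, (p < j)%N -> dot a v (y p) = 0) ->
    r \in S -> dot a v v = b j * (t * r) ->
  exists x : 'rV[F]_m, [/\ forall k, x 0 k \in S, forall k, a k = 0 -> x 0 k = 0,
    forall p, (p < j)%N -> dot a x (y p) = 0 & dot a x x = b j].
Proof.
move=> vS v1 v_supp vy rS vv.
have [a0|[a0 aS]] := a_dvd k0.
  by move/eqP: (v_supp _ a0); rewrite v1 oner_eq0.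
pose c (p : 'I_j) := - (b j / b p * y p 0 k0).
pose pr := \sum_(p < j) c p *: y p.
pose f := (b j / a k0) *: delta_mx 0 k0 + pr.
have dot_delta w : dot a (delta_mx 0 k0) w = a k0 * w 0 k0.
  rewrite /dot (bigD1 k0) //= big1 ?addr0 => [|k kk0].
    by rewrite !mxE !eqxx mulr1.
  by rewrite !mxE (negPf kk0) andbF mulr0 mul0r.
have cS p : c p \in S by rewrite rpredN rpredM ?yS // b_dvd // ltnW.
have fS k : f 0 k \in S.
  rewrite !mxE rpredD //; first by rewrite rpredM // rpred_nat.
  by rewrite summxE rpred_sum // => p _; rewrite mxE rpredM ?yS.
have f_supp k : a k = 0 -> f 0 k = 0.
  move=> ak0; rewrite !mxE summxE big1 => [|p _]; last by rewrite mxE y_supp // mulr0.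
  rewrite addr0 andTb; case: eqP => [kk0|_]; last by rewrite mulr0.
  by rewrite -kk0 ak0 eqxx in a0.
have fy q : (q < j)%N -> dot a f (y q) = 0.
  move=> lt_qj; rewrite dot_lin dot_delta dot_suml.
  rewrite (bigD1 (Ordinal lt_qj)) //= big1 => [|p pq].
    rewrite addr0 y_ortho // eqxx mulr1n /c /=; field.
    by rewrite a0 b0 // ltnW.
  by rewrite y_ortho //; move: pq; rewrite -val_eqE => /negPf->; rewrite mulr0.
have fv : dot a f v = b j.
  rewrite dot_lin dot_delta dot_suml v1 big1 => [|p _].
    by field; exact: a0.
  by rewrite dot_sym vy // mulr0.
have ff : dot a f f = b j * f 0 k0.
  rewrite {1}/f dot_lin dot_delta dot_suml big1 => [|p _].
    by field; exact: a0.
  by rewrite dot_sym fy // mulr0.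
clearbody f.
have sS : f 0 k0 - 1 \in S by rewrite rpredB ?rpred1.
have [X XS X0] := quadratic_root rS sS.
exists (X *: v + f); split.
- by move=> k; rewrite !mxE rpredD // rpredM.
- by move=> k ak0; rewrite !mxE f_supp // v_supp // mulr0 add0r.
- by move=> p lt_pj; rewrite dot_lin vy // fy // mulr0 addr0.
rewrite dot_lin !dot_linr vv ff (dot_sym a v f) fv.
by apply/eqP; rewrite -subr_eq0 -(mulr0 (b j)) -[X in _ == _ * X]X0; apply/eqP; ring.
Qed.

(** Divide [v] by its coordinate of least valuation.  Its norm becomes
    [b j * d ^+ 2]; then either [d^-1] is integral, and scaling by it is enough, or
    [d] is in the maximal ideal. *)
Lemma represent_integral (v : 'rV[F]_m) c : v != 0 ->
    (forall k, a k = 0 -> v 0 k = 0) ->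
    (forall p, (p < j)%N -> dot a v (y p) = 0) -> dot a v v = b j * c ^+ 2 ->
  exists x : 'rV[F]_m, [/\ forall k, x 0 k \in S, forall k, a k = 0 -> x 0 k = 0,
    forall p, (p < j)%N -> dot a x (y p) = 0 & dot a x x = b j].
Proof.
move=> /rV0Pn[i vi] v_supp vy vv.
have [k0 [_ vk0 minS]] :=
  @least_valuation _ (fun k => v 0 k) (enum 'I_m) i (mem_enum _ i) vi.
have dotZl d u w : dot a (d *: u) w = d * dot a u w.
  rewrite mulr_sumr; apply: eq_bigr => k _; rewrite mxE; ring.
have dotZr d u w : dot a w (d *: u) = d * dot a w u.
  by rewrite dot_sym dotZl dot_sym.
pose u := (v 0 k0)^-1 *: v; pose d := c / v 0 k0.
have uS k : u 0 k \in S by rewrite mxE mulrC minS // mem_enum.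
have u_supp k : a k = 0 -> u 0 k = 0 by move=> ak0; rewrite mxE (v_supp k) // mulr0.
have uy p : (p < j)%N -> dot a u (y p) = 0.
  by move=> lt_pj; rewrite dotZl vy // mulr0.
have uu : dot a u u = b j * d ^+ 2.
  by rewrite dotZl dotZr vv /d; field.
have u1 : u 0 k0 = 1 by rewrite mxE mulVf.
have [d0|d0] := eqVneq d 0.
  apply: (@represent_primitive u k0 0) => //; first exact: rpred0.
  by rewrite uu d0 expr0n /= !mulr0.
have [dV|[z zS dz]] := S_val d^-1.
  exists (d^-1 *: u); split.
  - by move=> k; rewrite mxE rpredM.
  - by move=> k ak0; rewrite mxE u_supp // mulr0.
  - by move=> p lt_pj; rewrite dotZl uy // mulr0.
  by rewrite dotZl dotZr uu; field; exact: d0.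
apply: (@represent_primitive u k0 (t * z ^+ 2)) => //.
  by rewrite rpredM // rpredX.
rewrite uu; have -> : d = t * z by rewrite -[LHS]mulr1 -dz mulVKf.
by ring.
Qed.

End Step.
End Valuation.

(** * Descent for diagonal lattices *)

(** [S] is a valuation ring of [F] with maximal ideal generated by [t], and [SE] plays
    the role of the integral closure of [S] in [E]. *)
Section Descent.
Variables (F : fieldType) (S : subringClosed F) (t : F).
Hypothesis tS : t \in S.
Hypothesis tN : t^-1 \notin S.
Hypothesis half : (2 : F)^-1 \in S.
Hypothesis two_neq0 : 2 != 0 :> F.
Hypothesis S_val : forall x, x \in S \/ exists2 y, y \in S & x * (t * y) = 1.
Hypothesis S_inv_sqrt : forall s, s \in S ->
  exists2 d, d \in S & d ^+ 2 * (1 + t * s) = 1.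
Variables (E : fieldExtType F) (SE : subringClosed E).
Hypothesis E_odd : odd (\dim {:E}).
Hypothesis S_SE : forall x, x \in S -> x%:A \in SE.
Hypothesis SE_inv_sqrt : forall s, s \in SE ->
  exists2 d, d \in SE & d ^+ 2 * (1 + t%:A * s) = 1.

Local Notation phi := (in_alg E).

Variables (m n : nat) (a : 'I_m -> F) (b : nat -> F) (z : nat -> 'rV[E]_m).
Hypothesis a0 : forall k, a k != 0.
Hypothesis b0 : forall p, (p < n)%N -> b p != 0.
Hypothesis b_dvd : forall p q, (p <= q)%N -> (q < n)%N -> b q / b p \in S.
Hypothesis zS : forall p k, (p < n)%N -> z p 0 k \in SE.
Hypothesis z_ortho : ortho_system (dot (phi \o a)) (phi \o b) n z.

Lemma dot_map (w : 'I_m -> F) u v :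
  dot (phi \o w) (map_mx phi u) (map_mx phi v) = phi (dot w u v).
Proof. by rewrite rmorph_sum; apply: eq_bigr => k _; rewrite !mxE !rmorphM. Qed.

(** The basis vectors whose norm does not divide [b j] are given norm [0], so that
    all the sublattices under consideration share one coordinate space. *)
Definition cut j (k : 'I_m) : F := if b j / a k \in S then a k else 0.

Lemma cut_eq0 j k : cut j k = 0 -> b j / a k \notin S.
Proof. by rewrite /cut; case: ifP => // _ /eqP; rewrite (negPf (a0 k)). Qed.

(** The norms that do not divide [b j] are multiples of [t * b j]. *)
Lemma cut_rest j k : (j < n)%N -> exists2 s, s \in S & a k - cut j k = t * b j * s.
Proof.
move=> lt_jn; rewrite /cut; case: ifP => [_|/negbT baS].
  by exists 0; rewrite ?rpred0 // subrr mulr0.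
have [bS|[s sS e]] := S_val (b j / a k); first by rewrite bS in baS.
exists s => //.
  by rewrite subr0 -[LHS]mulr1 -e; field; exact: a0.
Qed.

Lemma cut_dot j (u v : 'rV[F]_m) :
  (forall k, cut j k = 0 -> u 0 k = 0) -> dot (cut j) u v = dot a u v.
Proof.
move=> u0; apply: eq_bigr => k _; rewrite /cut; case: ifP => // baS.
by rewrite u0 ?mulr0 // /cut baS.
Qed.

(** By [cut_rest], cutting changes the Gram matrix of the [z p] by elements of
    [t * b j * SE]. *)
Lemma cut_system j : (j < n)%N ->
  exists w, ortho_system (dot (phi \o cut j)) (phi \o b) j.+1 w.
Proof.
move=> lt_jn.
apply: (@normalize_system _ _ (dot (phi \o cut j)) (@dot_sym _ _ _) (@dot_lin _ _ _)
   SE t%:A (S_SE tS) SE_inv_sqrt (phi \o b) (phi (b j)) j.+1 z).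
- by move=> p lt_pj; rewrite /comp fmorph_eq0 b0 //; exact: leq_ltn_trans lt_jn.
- by move=> p lt_pj; rewrite /comp -fmorph_div; apply: S_SE; exact: b_dvd.
move=> p q lt_pj lt_qj.
have lt_pn : (p < n)%N by exact: leq_ltn_trans lt_jn.
have lt_qn : (q < n)%N by exact: leq_ltn_trans lt_jn.
pose s k := sval (cid2 (cut_rest k lt_jn)).
have [sS sE] : (forall k, s k \in S) /\ forall k, a k - cut j k = t * b j * s k.
  by split=> k; rewrite /s; case: cid2.
exists (- \sum_k phi (s k) * z p 0 k * z q 0 k).
  by rewrite rpredN rpred_sum // => k _; rewrite !rpredM ?zS // S_SE.
rewrite -z_ortho // mulrN mulr_sumr -sumrB; apply: eq_bigr => k _ /=.
have -> : a k = cut j k + t * b j * s k by rewrite -sE addrC subrK.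
by rewrite -!in_algE rmorphD !rmorphM /=; ring.
Qed.

(** Witt's theorem gives a vector [x] over [E], Springer's theorem descends it to
    [F], and [represent_integral] makes it integral. *)
Lemma descent_step j (y : nat -> 'rV[F]_m) : (j < n)%N ->
    (forall p k, (p < j)%N -> y p 0 k \in S) ->
    (forall p k, (p < j)%N -> cut p k = 0 -> y p 0 k = 0) ->
    ortho_system (dot a) b j y ->
  exists x : 'rV[F]_m, [/\ forall k, x 0 k \in S, forall k, cut j k = 0 -> x 0 k = 0,
    forall p, (p < j)%N -> dot a x (y p) = 0 & dot a x x = b j].
Proof.
move=> lt_jn yS y_supp y_ortho.
have lt_pn p : (p <= j)%N -> (p < n)%N by move=> le_pj; exact: leq_ltn_trans lt_jn.
have y_cut p k : (p < j)%N -> cut j k = 0 -> y p 0 k = 0.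
  move=> lt_pj /cut_eq0 cjk; apply: y_supp => //; rewrite /cut; case: ifP => // bpS.
  case/negP: cjk; have -> : b j / a k = (b j / b p) * (b p / a k).
    by field; rewrite a0 b0 // lt_pn // ltnW.
  by rewrite rpredM // b_dvd // ltnW.
have y_ortho' : ortho_system (dot (cut j)) b j y.
  by move=> p q lt_pj lt_qj; rewrite cut_dot ?y_ortho // => k; exact: y_cut.
have [w wO] := cut_system lt_jn.
have two_E : 2 != 0 :> E by rewrite -(rmorph_nat phi) fmorph_eq0.
have [||x [xx xy]] := @witt_complement _ _ (dot (phi \o cut j)) (@dot_sym _ _ _)
   (@dot_lin _ _ _) two_E (phi \o b) j (fun p => map_mx phi (y p)) w _ wO.
- by move=> p q lt_pj lt_qj; rewrite dot_map y_ortho' // rmorphMn.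
- by move=> p le_pj; rewrite /comp fmorph_eq0 b0 // lt_pn.
(* [cut j] ignores the coordinates of [x] outside its support; they are set to
   [0] because [v] must not vanish on the support. *)
pose T k : F := (cut j k != 0)%:R.
pose x' : 'rV[E]_m := \row_k (phi (T k) * x 0 k).
have x'_dot u : dot (phi \o cut j) x' u = dot (phi \o cut j) x u.
  apply: eq_bigr => k _; rewrite mxE /T /=.
  by case: eqP => [->|_]; rewrite ?scale0r ?mul0r // scale1r mul1r.
(* [C1] expresses orthogonality to the [y p], and [C2] the support condition. *)
pose C1 : 'M[F]_(m, j) := \matrix_(k, p) (cut j k * y p 0 k).
pose C2 : 'M[F]_m := diag_mx (\row_k (1 - T k)).
have x'C : x' *m map_mx phi (row_mx C1 C2) = 0.
  rewrite map_row_mx mul_mx_row; apply/eqP; rewrite row_mx_eq0; apply/andP; split.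
    apply/eqP/rowP => p; rewrite [RHS]mxE -(xy p (ltn_ord p)) -x'_dot mxE.
    by apply: eq_bigr => k _; rewrite !mxE rmorphM /=; ring.
  apply/eqP/rowP => k; rewrite map_diag_mx mul_mx_diag !mxE /T.
  by case: eqP => _ /=; rewrite ?scale0r ?mul0r // subrr scale0r mulr0.
have qx' : quad (map_mx phi (diag_mx (\row_k cut j k))) x' = (b j)%:A.
  have -> : map_mx phi (diag_mx (\row_k cut j k)) = diag_mx (\row_k (phi \o cut j) k).
    by rewrite map_diag_mx; congr diag_mx; apply/rowP => k; rewrite !mxE.
  by rewrite quad_diag x'_dot dot_sym x'_dot xx.
have [v [v0 vC [c qv]]] := springer_represent E_odd (b0 lt_jn) x'C qx'.
rewrite quad_diag in qv.
have /eqP := vC; rewrite mul_mx_row row_mx_eq0 => /andP[/eqP vC1 /eqP vC2].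
have v_supp k : cut j k = 0 -> v 0 k = 0.
  move=> ck; have /rowP/(_ k) := vC2; rewrite mul_mx_diag !mxE /T ck eqxx.
  by rewrite subr0 mulr1.
have vy p : (p < j)%N -> dot (cut j) v (y p) = 0.
  move=> lt_pj; have /rowP/(_ (Ordinal lt_pj)) := vC1; rewrite !mxE => e.
  by rewrite -[RHS]e; apply: eq_bigr => k _; rewrite !mxE /=; ring.
have [|||x1 [x1S x1_supp x1y x1x]] := @represent_integral F S t tS tN half two_neq0
  S_val S_inv_sqrt m (cut j) b j y _ _ _ yS y_cut y_ortho' v c v0 v_supp vy qv.
- by move=> k; rewrite /cut; case: ifP => [bS|_]; [right|left].
- by move=> p le_pj; rewrite b0 // lt_pn.
- by move=> p le_pj; exact: b_dvd.
exists x1; split=> // [p lt_pj|]; first by rewrite -(@cut_dot j) // x1y.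
by rewrite -(@cut_dot j).
Qed.

Lemma descent : exists y : nat -> 'rV[F]_m,
  (forall p k, (p < n)%N -> y p 0 k \in S) /\ ortho_system (dot a) b n y.
Proof.
suff [y [yS [_ yO]]] : exists y : nat -> 'rV[F]_m,
  (forall p k, (p < n)%N -> y p 0 k \in S) /\
  (forall p k, (p < n)%N -> cut p k = 0 -> y p 0 k = 0) /\
  ortho_system (dot a) b n y; first by exists y.
have step j : (j <= n)%N -> exists y : nat -> 'rV[F]_m,
  (forall p k, (p < j)%N -> y p 0 k \in S) /\
  (forall p k, (p < j)%N -> cut p k = 0 -> y p 0 k = 0) /\
  ortho_system (dot a) b j y.
  elim: j => [_|j IH lt_jn]; first by exists (fun=> 0).
  have [y [yS [y_supp yO]]] := IH (ltnW lt_jn).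
  have [x [xS x_supp xy xx]] := descent_step lt_jn yS y_supp yO.
  exists (fun p => if (p < j)%N then y p else x); split.
    by move=> p k _; case: ltnP => [lt_pj|_ //]; exact: yS.
  have lt_eq p : (p < j.+1)%N -> (p < j)%N = false -> p = j.
    by rewrite ltnS leq_eqVlt => /orP[/eqP->|->].
  split=> [p k lt_pSj|p q lt_pSj lt_qSj].
    case: ifP => [lt_pj|/(lt_eq _ lt_pSj) ->]; [exact: y_supp|exact: x_supp].
  case: ifP => [lt_pj|/(lt_eq _ lt_pSj) ->]; case: ifP => [lt_qj|/(lt_eq _ lt_qSj) ->].
  - exact: yO.
  - by rewrite dot_sym xy // (ltn_eqF lt_pj).
  - by rewrite xy // (gtn_eqF lt_qj).
  - by rewrite xx eqxx.
exact: step (leqnn n).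
Qed.

End Descent.

(** * Orthogonal bases of lattices *)

Section OrthogonalGenerators.
Variables (R : comNzRingType) (M : lmodType R).

Inductive spanned (s : seq M) : M -> Prop :=
| spanned_mem u : u \in s -> spanned s u
| spanned0 : spanned s 0
| spanned_lin c u v : spanned s u -> spanned s v -> spanned s (c *: u + v).

Lemma spanned_trans s s' x :
  {in s, forall u, spanned s' u} -> spanned s x -> spanned s' x.
Proof.
move=> ss'; elim=> [u /ss'//||c u v _ su _ sv]; first exact: spanned0.
exact: spanned_lin.
Qed.

Lemma spannedP s x : spanned s x -> exists c : 'I_(size s) -> R, x = \sum_i c i *: s`_i.
Proof.
elim=> [u us||c _ _ _ [d ->] _ [d' ->]].
- have lt_us : (index u s < size s)%N by rewrite index_mem.
  exists (fun i => (i == Ordinal lt_us)%:R).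
  rewrite (bigD1 (Ordinal lt_us)) //= big1 => [|i /negPf->]; last by rewrite scale0r.
  by rewrite eqxx scale1r addr0 nth_index.
- by exists (fun=> 0); rewrite big1 // => i _; rewrite scale0r.
exists (fun i => c * d i + d' i).
rewrite scaler_sumr -big_split; apply: eq_bigr => i _ /=.
by rewrite scalerA scalerDl.
Qed.

Lemma spanned_sum (I : finType) (P : pred I) s (c : I -> R) (u : I -> M) :
  (forall i, P i -> spanned s (u i)) -> spanned s (\sum_(i | P i) c i *: u i).
Proof.
move=> us; apply: (big_ind (spanned s)) => [|x y sx sy|i Pi]; first exact: spanned0.
  by rewrite -[x]scale1r; exact: spanned_lin.
by rewrite -[_ *: _]addr0; apply: spanned_lin; [exact: us|exact: spanned0].
Qed.

Variables (F : fieldType) (iota : {rmorphism R -> F}) (S : subringClosed F) (t : F).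
Hypothesis tS : t \in S.
Hypothesis tN : t^-1 \notin S.
Hypothesis half : (2 : F)^-1 \in S.
Hypothesis two_neq0 : 2 != 0 :> F.
Hypothesis S_val : forall x, x \in S \/ exists2 y, y \in S & x * (t * y) = 1.
Hypothesis SP : forall x, reflect (exists r, x = iota r) (x \in S).

Variable B : M -> M -> F.
Hypothesis B_sym : forall u v, B u v = B v u.
Hypothesis B_lin : forall a u v w, B (a *: u + v) w = iota a * B u w + B v w.

Let iotaS r : iota r \in S. Proof. by apply/SP; exists r. Qed.

Let B0 w : B 0 w = 0.
Proof.
apply: (addrI (B 0 w)); rewrite addr0 -{3}(addr0 (0 : M)) -{3}(scale1r 0).
by rewrite B_lin rmorph1 mul1r.
Qed.

Lemma spanned_bound s beta : {in s &, forall u v, B u v / beta \in S} ->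
  forall u v, spanned s u -> spanned s v -> B u v / beta \in S.
Proof.
move=> sS u v su sv.
have {su} su w : w \in s -> B u w / beta \in S.
  move=> ws; elim: su => [x xs||c x y _ xS _ yS]; first exact: sS.
    by rewrite B0 mul0r rpred0.
  by rewrite B_lin mulrDl -mulrA rpredD // rpredM.
rewrite B_sym; elim: sv => [x xs||c x y _ xS _ yS]; first by rewrite B_sym su.
  by rewrite B0 mul0r rpred0.
by rewrite B_lin mulrDl -mulrA rpredD // rpredM.
Qed.

Lemma unit_or_multiple x : x \in S ->
  (x != 0 /\ x^-1 \in S) \/ exists2 y, y \in S & x = t * y.
Proof.
move=> xS; have [->|x0] := eqVneq x 0.
  by right; exists 0; rewrite ?rpred0 // mulr0.
have [xV|[y yS e]] := S_val x^-1; [by left|right; exists y => //].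
by rewrite -[LHS]mulr1 -e mulVKf.
Qed.

(** Let [B u0 v0] have the least valuation among all products.  If neither
    [B u0 u0] nor [B v0 v0] has that valuation, then
    [B (u0 + v0) (u0 + v0) = B u0 u0 + 2 * B u0 v0 + B v0 v0] has it, [2] being a
    unit. *)
Lemma minimal_vector s u v : u \in s -> v \in s -> B u v != 0 ->
  exists x s', [/\ size s = (size s').+1, spanned s x, {in s', forall w, spanned s w},
    {in s, forall w, spanned (x :: s') w} &
    B x x != 0 /\ {in s &, forall w w', B w w' / B x x \in S}].
Proof.
move=> us vs uv0.
have [||[u0 v0] [/= uv0s beta0 minS]] :=
    @least_valuation F S t tS S_val _ (fun p => B p.1 p.2)
      [seq (u, v) | u <- s, v <- s] (u, v).
- exact: allpairs_f.
- by [].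
have /andP[u0s v0s] : (u0 \in s) && (v0 \in s).
  by move/allpairsP: uv0s => -[[w w'] [/= ws ws' [-> ->]]]; rewrite ws.
set beta := B u0 v0 in beta0 minS.
have betaS : {in s &, forall w w', B w w' / beta \in S}.
  by move=> w w' ws ws'; apply: (minS (w, w')); exact: allpairs_f.
have unit_bound x : (B x x / beta != 0 /\ (B x x / beta)^-1 \in S) ->
    B x x != 0 /\ {in s &, forall w w', B w w' / B x x \in S}.
  move=> [xb0 xbV]; have x0 : B x x != 0.
    by apply: contraNneq xb0 => ->; rewrite mul0r.
  split=> // w w' ws ws'.
  have -> : B w w' / B x x = (B w w' / beta) * (B x x / beta)^-1.
    by field; rewrite x0 beta0.
  by rewrite rpredM // betaS.
have self x : x \in s -> size s = (size (rem x s)).+1 /\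
    {in rem x s, forall w, spanned s w} /\ {in s, forall w, spanned (x :: rem x s) w}.
  move=> xs; have ps := perm_to_rem xs; split; first by rewrite (perm_size ps).
  split=> w ws; first by apply: spanned_mem; rewrite (perm_mem ps) in_cons ws orbT.
  by apply: spanned_mem; rewrite -(perm_mem ps).
have [uU|[a aS ua]] := unit_or_multiple (betaS _ _ u0s u0s).
  have [? [? ?]] := self _ u0s.
  by exists u0, (rem u0 s); split=> //; [exact: spanned_mem|exact: unit_bound].
have [vU|[c cS vc]] := unit_or_multiple (betaS _ _ v0s v0s).
  have [? [? ?]] := self _ v0s.
  by exists v0, (rem v0 s); split=> //; [exact: spanned_mem|exact: unit_bound].
have uNv : v0 != u0.
  apply: contraNneq tN => e.
  have buu : B u0 u0 = beta by rewrite /beta e.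
  have ta1 : t * a = 1 by rewrite -ua buu divff.
  have t0 : t != 0 by apply/eqP => t0; move/eqP: ta1; rewrite t0 mul0r eq_sym oner_eq0.
  by rewrite -[t^-1]mulr1 -ta1 mulKf.
have [sz [remS sRem]] := self _ u0s.
exists (1 *: u0 + v0), (rem u0 s); split=> //.
- by apply: spanned_lin; exact: spanned_mem.
- have v0rem : v0 \in rem u0 s.
    by move: v0s; rewrite (perm_mem (perm_to_rem u0s)) in_cons (negPf uNv).
  move=> w /sRem; apply: spanned_trans => y.
  rewrite in_cons => /orP[/eqP->|ys]; last first.
    by apply: spanned_mem; rewrite in_cons ys orbT.
  have u0E : u0 = 1 *: (1 *: u0 + v0) + ((-1) *: v0 + 0).
    by rewrite !scale1r scaleN1r addr0 addrK.
  rewrite [X in spanned _ X]u0E; apply: spanned_lin.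
    by apply: spanned_mem; rewrite mem_head.
  apply: spanned_lin; last exact: spanned0.
  by apply: spanned_mem; rewrite in_cons v0rem orbT.
apply: unit_bound; set x := 1 *: u0 + v0.
have xx : B x x / beta = 2 + t * (a + c).
  rewrite mulrDr -ua -vc /x !(B_lin, B_sym _ (_ *: _ + _)) rmorph1 (B_sym v0) -/beta.
  by field; exact: beta0.
have xS : B x x / beta \in S.
  by rewrite xx !(rpredD, rpredM) // rpred1.
have [//|[y yS xy]] := unit_or_multiple xS.
case/negP: tN.
have -> : t^-1 = 2^-1 * (y - (a + c)).
  have t0 : t != 0.
    apply: contraTneq half => t0; move/eqP: two_neq0.
    by rewrite -[2]addr0 -{1}(mul0r (a + c)) -t0 -xx xy t0 mul0r.
  have e : t * (y - (a + c)) = 2 by rewrite mulrBr -xy xx addrK.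
  by apply: (mulfI t0); rewrite mulrCA e divff // mulVf.
by rewrite rpredM // rpredB // rpredD.
Qed.

(** Split off a vector [x] whose norm divides all products: the projections onto [x]
    then have coefficients in [R].  This also makes each norm divide the next. *)
Lemma orthogonal_generators (s : seq M) : exists e : seq M,
  [/\ size e = size s, {in s, forall u, spanned e u}, {in e, forall u, spanned s u},
   forall i j, (i < size e)%N -> (j < size e)%N -> i != j -> B e`_i e`_j = 0 &
   forall i j, (i <= j)%N -> (j < size e)%N -> B e`_j e`_j / B e`_i e`_i \in S].
Proof.
have [n] := ubnP (size s); elim: n s => [//|n IH] s; rewrite ltnS => sn.
case: (pselect (exists u v, [/\ u \in s, v \in s & B u v != 0])); last first.
  move=> s0; have {}s0 u v : u \in s -> v \in s -> B u v = 0.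
    by move=> us vs; apply: contrapT => /eqP uv; apply: s0; exists u, v.
  exists s; split=> // [u|u|i j si sj _|i j ij sj]; try exact: spanned_mem.
    by rewrite s0 ?mem_nth.
  by rewrite [X in X / _]s0 ?mul0r ?rpred0 // mem_nth.
move=> [u [v [us vs uv]]].
have [x [s' [sz sx s's ss' [x0 xS]]]] := minimal_vector us vs uv.
have spannedS := spanned_bound xS.
have [|r rE] := @choice M R (fun y r => spanned s y -> B y x = iota r * B x x).
  move=> y; case: (pselect (spanned s y)) => [sy|]; last by exists 0.
  have /SP[r e] := spannedS _ _ sy sx; exists r => _.
  by rewrite -e divfK.
pose s'' := [seq (- r y) *: x + y | y <- s'].
have [|e [e_size s''e es'' e_ortho e_chain]] := IH s''.
  by rewrite size_map; move: sn; rewrite sz.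
have s''_span w : w \in s'' -> spanned s w.
  by move=> /mapP[y ys' ->]; apply: spanned_lin => //; exact: s's.
have e_span w : spanned s'' w -> spanned s w by apply: spanned_trans.
have xe w : spanned s'' w -> B w x = 0.
  elim=> [_ /mapP[y ys' ->]||c y z _ yx _ zx].
  - by rewrite B_lin (rE y (s's _ ys')) rmorphN mulNr addNr.
  - exact: B0.
  by rewrite B_lin yx zx mulr0 addr0.
have nth_span i : (i < size e)%N -> spanned s'' e`_i.
  by move=> ie; apply: es''; exact: mem_nth.
exists (x :: e); split.
- by rewrite /= e_size size_map sz.
- move=> w /ss'; apply: spanned_trans => y; rewrite in_cons => /orP[/eqP->|ys'].
    by apply: spanned_mem; rewrite mem_head.
  have -> : y = r y *: x + ((- r y) *: x + y) by rewrite scaleNr addNKr.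
  apply: spanned_lin; first by apply: spanned_mem; rewrite mem_head.
  have : spanned e ((- r y) *: x + y) by apply: s''e; exact: map_f.
  by apply: spanned_trans => z ze; apply: spanned_mem; rewrite in_cons ze orbT.
- move=> w; rewrite in_cons => /orP[/eqP->//|/es''].
  exact: e_span.
- case=> [|i] [|j] //=; rewrite !ltnS => ie je ij.
  + by rewrite B_sym xe //; exact: nth_span.
  + by rewrite xe //; exact: nth_span.
  + exact: e_ortho.
case=> [|i] [|j] //=; rewrite ?ltnS => ij je.
- by rewrite divff // rpred1.
- by apply: spannedS; apply: e_span; exact: nth_span.
- exact: e_chain.
Qed.

End OrthogonalGenerators.

(** The symmetric bilinear form of a quadratic module, normalised so that [qform] is
    its diagonal. *)
Section HalfPolar.
Variables (A : comNzRingType) (K : fieldType) (iota : {rmorphism A -> K}).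
Variable M : quadratic_module iota.

Definition half_polar (u v : M) : K :=
  polar (qform (q := M)) (tpure iota 1 u) (tpure iota 1 v) / 2.

Hypothesis two_neq0 : 2 != 0 :> K.
Hypothesis QP : quadratic_form (qform (q := M)).

Lemma tpure_lin c (u v : M) :
  tpure iota 1 (c *: u + v) = iota c *: tpure iota 1 u + tpure iota 1 v.
Proof. by rewrite tpureDr -tpureA mul1r tpureZ mulr1. Qed.

Lemma half_polar_sym u v : half_polar u v = half_polar v u.
Proof. by rewrite /half_polar polarC. Qed.

Lemma half_polar_lin c u v w :
  half_polar (c *: u + v) w = iota c * half_polar u w + half_polar v w.
Proof. by rewrite /half_polar tpure_lin (QP.2.1 _) mulrDl mulrA. Qed.

Lemma half_polarE u : qform (tpure iota 1 u) = half_polar u u.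
Proof.
rewrite /half_polar /polar -mulr2n -scaler_nat QP.1; field; exact: two_neq0.
Qed.

Lemma half_polar0l w : half_polar 0 w = 0.
Proof.
have := half_polar_lin (-1) 0 0 w; rewrite scaler0 addr0 => ->.
by rewrite rmorphN rmorph1 mulN1r addNr.
Qed.

Lemma half_polar_suml (I : finType) (c : I -> A) (u : I -> M) w :
  half_polar (\sum_i c i *: u i) w = \sum_i iota (c i) * half_polar (u i) w.
Proof.
apply: (big_ind2 (fun u s => half_polar u w = s)) => [|x _ y _ <- <-|i _].
- exact: half_polar0l.
- by have := half_polar_lin 1 x y w; rewrite scale1r rmorph1 mul1r.
by rewrite -[c i *: _]addr0 half_polar_lin half_polar0l addr0.
Qed.

Lemma half_polar_sumr (I : finType) (c : I -> A) (u : I -> M) w :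
  half_polar w (\sum_i c i *: u i) = \sum_i iota (c i) * half_polar w (u i).
Proof.
rewrite half_polar_sym half_polar_suml; apply: eq_bigr => i _.
by rewrite half_polar_sym.
Qed.

Lemma half_polar_radical u : nondegenerate_form (qform (q := M)) ->
  (forall v, half_polar u v = 0) -> tpure iota 1 u = 0.
Proof.
move=> nondeg u0; apply: nondeg.
have pu v : polar (qform (q := M)) (tpure iota 1 u) (tpure iota 1 v) = 0.
  apply/eqP; have /eqP := u0 v.
  by rewrite /half_polar mulf_eq0 invr_eq0 (negPf two_neq0) orbF.
elim/tensor_ind => [|x y xu yu|c v].
- by rewrite -(scale0r 0) (polarZr QP) mul0r.
- by rewrite (polarDr QP) xu yu addr0.
by rewrite -[c]mulr1 -tpureZ (polarZr QP) pu mulr0.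
Qed.

End HalfPolar.

Section LatticeBasis.
Variables (R : comNzRingType) (F : fieldType) (iota : {rmorphism R -> F}).
Variables (S : subringClosed F) (t : F).
Hypothesis iota_inj : injective iota.
Hypothesis tS : t \in S.
Hypothesis tN : t^-1 \notin S.
Hypothesis half : (2 : F)^-1 \in S.
Hypothesis two_neq0 : 2 != 0 :> F.
Hypothesis S_val : forall x, x \in S \/ exists2 y, y \in S & x * (t * y) = 1.
Hypothesis SP : forall x, reflect (exists r, x = iota r) (x \in S).

(** The coefficient of least valuation in a relation divides the others.  As there
    is no torsion it can be cancelled, and one generator is superfluous. *)
Lemma minimal_generators_free (M : lmodType R) n (e : 'I_n -> M) (s : seq M) :
    torsion_free M -> (forall x, spanned s x) ->
    (forall u, u \in s -> spanned [seq e i | i <- enum 'I_n] u) ->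
    (forall s' : seq M, (forall x, spanned s' x) -> (n <= size s')%N) ->
  forall c : 'I_n -> R, \sum_i c i *: e i = 0 -> forall i, c i = 0.
Proof.
move=> tf s_gen se n_min c c_rel i; apply/eqP; apply: contraT => ci.
have e_gen x : spanned [seq e i | i <- enum 'I_n] x by apply: spanned_trans (s_gen x).
have ci' : iota (c i) != 0 by rewrite -(rmorph0 iota) (inj_eq iota_inj).
have [k0 [_ ck0 minS]] := @least_valuation F S t tS S_val _ (fun k => iota (c k))
  (enum 'I_n) i (mem_enum _ i) ci'.
have [r rE] : exists r : 'I_n -> R, forall k, c k = c k0 * r k.
  have ex k : exists r, c k = c k0 * r.
    have /SP[r e1] := minS k (mem_enum _ k); exists r; apply: iota_inj.
    by rewrite rmorphM -e1 mulrC divfK.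
  by exists (fun k => sval (cid (ex k))) => k; case: cid.
have [/eqP|rel] : c k0 = 0 \/ \sum_k r k *: e k = 0.
- apply: tf; rewrite scaler_sumr -[RHS]c_rel; apply: eq_bigr => k _.
  by rewrite scalerA -rE.
- by move/eqP => ck00; rewrite ck00 rmorph0 eqxx in ck0.
have rk0 : r k0 = 1.
  by apply: iota_inj; apply: (mulfI ck0); rewrite -rmorphM -rE rmorph1 mulr1.
pose s' := [seq e k | k <- enum (predC1 k0)].
have s'_mem k : k != k0 -> spanned s' (e k).
  by move=> kk0; apply: spanned_mem; apply: map_f; rewrite mem_enum.
have s'_gen x : spanned s' x.
  apply: spanned_trans (e_gen x) => _ /mapP[k _ ->].
  have [->|] := eqVneq k k0; last exact: s'_mem.
  have -> : e k0 = \sum_(k | k != k0) (- r k) *: e k.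
    apply/eqP; rewrite -subr_eq0 -sumrN.
    rewrite (eq_bigr (fun k => r k *: e k)) => [|l _]; last first.
      by rewrite scaleNr opprK.
    by move: rel; rewrite (bigD1 k0) //= rk0 scale1r => ->.
  exact: spanned_sum.
have := n_min _ s'_gen; rewrite size_map -cardE cardC1 card_ord.
by rewrite leqNgt prednK ?leqnn // (leq_ltn_trans _ (ltn_ord k0)).
Qed.

Variable M : quadratic_module iota.
Hypothesis ML : quadratic_lattice M.

Local Notation B := (@half_polar _ _ _ M).

(** An orthogonal generating set with as few elements as possible is a basis.  Its
    norms do not vanish, since a basis vector of norm [0] would be orthogonal to
    all of [F ⊗ M]. *)
Lemma lattice_basis : exists n (e : 'I_n -> M) (co : M -> 'I_n -> R),
  [/\ forall x, x = \sum_i co x i *: e i,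
      forall c u v i, co (c *: u + v) i = c * co u i + co v i,
      forall i j, i != j -> B (e i) (e j) = 0,
      forall i, B (e i) (e i) != 0 &
      forall i j : 'I_n, (i <= j)%N -> B (e j) (e j) / B (e i) (e i) \in S].
Proof.
have [[s0 s0_gen] tf QP nondeg] := ML.
pose gen n := `[< exists s : seq M, size s = n /\ forall x, spanned s x >].
have ex_gen : exists n, gen n.
  exists (size s0); apply/asboolP; exists s0; split=> // x.
  have [c ->] := s0_gen x; apply: spanned_sum => i _.
  by apply: spanned_mem; exact: mem_nth.
case: (ex_minnP ex_gen) => n /asboolP[s [s_size s_gen]] n_min.
have [el [el_size sel els el_ortho el_chain]] := orthogonal_generators tS tN half
  two_neq0 S_val SP (@half_polar_sym _ _ _ M) (half_polar_lin QP) s.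
rewrite s_size in el_size.
pose e (i : 'I_n) := el`_i.
have el_e : [seq e i | i <- enum 'I_n] = el.
  by rewrite -[RHS](mkseq_nth 0) el_size /mkseq -val_enum_ord -map_comp.
have e_free : forall c : 'I_n -> R, \sum_i c i *: e i = 0 -> forall i, c i = 0.
  apply: (@minimal_generators_free M n e s tf s_gen); first by rewrite el_e.
  by move=> s' s'_gen; apply: n_min; apply/asboolP; exists s'.
have e_gen x : exists c : 'I_n -> R, x = \sum_i c i *: e i.
  have : spanned el x by apply: spanned_trans (s_gen x).
  move=> /spannedP[c xc].
  exists (fun i => c (cast_ord (esym el_size) i)); rewrite xc.
  rewrite (reindex (cast_ord el_size)) /=.
    by apply: eq_bigr => i _; congr (c _ *: _); exact: val_inj.
  exists (cast_ord (esym el_size)) => i _; [exact: cast_ordK|exact: cast_ordKV].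
pose co x := sval (cid (e_gen x)).
have coE x : x = \sum_i co x i *: e i by rewrite /co; case: cid.
have co_uniq x (c : 'I_n -> R) : x = \sum_i c i *: e i -> co x =1 c.
  move=> xc i; apply/eqP; rewrite -subr_eq0; apply/eqP.
  apply: (e_free (fun i => co x i - c i)).
  rewrite (eq_bigr (fun i => co x i *: e i - c i *: e i)) => [|k _]; last first.
    by rewrite scalerBl.
  by rewrite sumrB -coE -xc subrr.
have co_lin c u v i : co (c *: u + v) i = c * co u i + co v i.
  apply: (co_uniq _ (fun i => c * co u i + co v i)).
  rewrite {1}(coE u) {1}(coE v) scaler_sumr -big_split; apply: eq_bigr => k _.
  by rewrite scalerA scalerDl.
exists n, e, co; split=> //.
- by move=> i j ij; apply: el_ortho; rewrite ?el_size.
- move=> i; apply/eqP => ei0.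
  have : tpure iota 1 (e i) = 0.
    apply: half_polar_radical => // v.
    rewrite (coE v) half_polar_sumr // big1 // => j _.
    have [<-|ij] := eqVneq i j; first by rewrite ei0 mulr0.
    by rewrite el_ortho ?mulr0 ?el_size.
  (* The coordinate number [i] extends to [F ⊗ M] and takes the value [1] at
     [1 ⊗ e i]. *)
  pose h (x : M) : F^o := iota (co x i).
  have hD : {morph h : x y / x + y}.
    by move=> x y; rewrite /h -[x]scale1r co_lin mul1r scale1r rmorphD.
  have hZ a x : h (a *: x) = idfun (iota a) *: h x.
    have := hD (a *: x) 0; rewrite addr0 => h0.
    have {}h0 : h 0 = 0 by apply: (addrI (h (a *: x))); rewrite -h0 addr0.
    by rewrite /h -[a *: x]addr0 co_lin rmorphD [X in _ + X]h0 addr0 rmorphM.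
  move=> /(congr1 (tlift idfun h)); rewrite (tlift_pure (k := idfun) hD hZ) /= scale1r.
  have -> : tlift idfun h (0 : tensor iota M) = 0.
    by have := tlift_scale (k := idfun) hD hZ 0 0; rewrite !scale0r.
  rewrite /h (co_uniq _ (fun k => (k == i)%:R)) => [|]; last first.
    rewrite (bigD1 i) //= eqxx scale1r big1 ?addr0 // => k /negPf->.
    by rewrite scale0r.
  by rewrite eqxx rmorph1 => /eqP; rewrite oner_eq0.
by move=> i j ij; apply: el_chain => //; rewrite el_size.
Qed.

End LatticeBasis.

(** * Lattices and their base change *)

Section Embeddings.
Variables (A : comNzRingType) (K : fieldType) (iota : {rmorphism A -> K}).
Hypothesis two_neq0 : 2 != 0 :> K.
Variables N M : quadratic_module iota.
Hypothesis NQ : quadratic_form (qform (q := N)).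
Hypothesis MQ : quadratic_form (qform (q := M)).

Lemma embeds_from_basis n (f : 'I_n -> N) (co : N -> 'I_n -> A) (u : 'I_n -> M) :
    (forall x, x = \sum_i co x i *: f i) ->
    (forall c x y i, co (c *: x + y) i = c * co x i + co y i) ->
    (forall i j, half_polar (u i) (u j) = half_polar (f i) (f j)) ->
  embeds N M.
Proof.
move=> coE co_lin uf.
pose sigma x := \sum_i co x i *: u i.
have sigma_lin : linear sigma.
  move=> c x y; rewrite /sigma scaler_sumr -big_split; apply: eq_bigr => i _.
  by rewrite co_lin scalerDl scalerA.
pose L : {linear N -> M} :=
  HB.pack sigma (GRing.isLinear.Build _ _ _ _ sigma sigma_lin).
exists L => x; rewrite [L x]/(sigma x) !half_polarE // {1 2}(coE x) /sigma.
rewrite !(half_polar_suml NQ, half_polar_suml MQ); apply: eq_bigr => i _.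
rewrite (half_polar_sumr NQ) (half_polar_sumr MQ); congr (_ * _).
by apply: eq_bigr => j _; rewrite uf.
Qed.

Lemma embeds_half_polar (sigma : {linear N -> M}) :
  (forall x, qform (tpure iota 1 x) = qform (tpure iota 1 (sigma x))) ->
  forall x y, half_polar (sigma x) (sigma y) = half_polar x y.
Proof.
move=> sq x y; rewrite /half_polar /polar -!tpureDr -!linearD.
by rewrite -!sq !tpureDr.
Qed.

End Embeddings.

Section BaseChange.
Variables (R S : comNzRingType) (F E : fieldType).
Variables (iota : {rmorphism R -> F}) (g : {rmorphism F -> E}).
Variables (rho : {rmorphism R -> S}) (j : {rmorphism S -> E}).
Hypothesis square : forall a, j (rho a) = g (iota a).
Hypothesis two_neq0 : 2 != 0 :> E.

Local Notation ext := (extend_lattice g rho j).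

Lemma extend_lattice_quadratic (M : quadratic_module iota) :
  quadratic_form (qform (q := M)) -> quadratic_form (qform (q := ext M)).
Proof.
move=> QP; have [QZ [QL QR]] := ext_form_quadratic g QP; split.
  by move=> c x; rewrite /= tensor_swapZ // QZ.
have polar_ext x y : polar (qform (q := ext M)) x y =
    polar (ext_form (qform (q := M)))
      (tensor_swap iota g rho j x) (tensor_swap iota g rho j y).
  by rewrite /polar /= tensor_swapD.
by split=> u c v w; rewrite /= !polar_ext tensor_swapD // tensor_swapZ // (QL, QR).
Qed.

Lemma half_polar_extend (M : quadratic_module iota) (u v : M) :
  quadratic_form (qform (q := M)) ->
  half_polar (M := ext M) (tpure rho 1 u) (tpure rho 1 v) = g (half_polar u v).
Proof.
move=> QP; rewrite /half_polar fmorph_div rmorph_nat; congr (_ / _).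
rewrite /polar /= -!tpureDr !tensor_swap_pure //.
by rewrite !rmorph1 mulr1 !ext_form_pure // expr1n !mul1r tpureDr !rmorphB.
Qed.

Lemma tensor_basis (M : lmodType R) m (e : 'I_m -> M) (co : M -> 'I_m -> R) :
    (forall x, x = \sum_i co x i *: e i) ->
  forall x : tensor rho M, exists s : 'I_m -> S, x = \sum_i s i *: tpure rho 1 (e i).
Proof.
move=> coE; elim/tensor_ind => [|x y [s ->] [s' ->]|b x].
- by exists (fun=> 0); rewrite big1 // => i _; rewrite scale0r.
- exists (fun i => s i + s' i); rewrite -big_split; apply: eq_bigr => i _.
  by rewrite scalerDl.
exists (fun i => b * rho (co x i)); rewrite {1}(coE x).
have tpure0 : tpure rho b (0 : M) = 0.
  by apply: (addrI (tpure rho b 0)); rewrite -tpureDr !addr0.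
rewrite (big_morph _ (tpureDr rho b) tpure0); apply: eq_bigr => i _.
by rewrite -tpureA tpureZ mulr1.
Qed.

(** The form of the extended embedding is compared with that of [ext N] on the
    elements [1 ⊗ x], which span [ext N]. *)
Lemma embeds_base_change (N M : quadratic_module iota) :
    quadratic_form (qform (q := N)) -> quadratic_form (qform (q := M)) ->
  embeds N M -> embeds (ext N) (ext M).
Proof.
move=> NQ MQ [sigma sq].
pose h (x : N) := tpure rho 1 (sigma x).
have hD : {morph h : x y / x + y} by move=> x y; rewrite /h linearD tpureDr.
have hZ a x : h (a *: x) = idfun (rho a) *: h x.
  by rewrite /h linearZ /= -tpureA mul1r tpureZ mulr1.
pose tau : tensor rho N -> tensor rho M := tlift idfun h.
have tau_lin : linear tau.
  move=> c x y; rewrite /tau (tlift_additive (k := idfun) hD hZ).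
  by rewrite (tlift_scale (k := idfun) hD hZ).
have tau_pure b x : tau (tpure rho b x) = b *: h x.
  exact: (tlift_pure (k := idfun) hD hZ).
pose L : {linear ext N -> ext M} :=
  HB.pack tau (GRing.isLinear.Build _ _ _ _ tau tau_lin).
exists L => x; rewrite [L x]/(tau x).
have NQ' := extend_lattice_quadratic NQ; have MQ' := extend_lattice_quadratic MQ.
rewrite !half_polarE //.
have tau0 : tau 0 = 0 by have := tau_lin (-1) 0 0; rewrite scaler0 addr0 scaleN1r addNr.
have tauD y z : tau (y + z) = tau y + tau z.
  by have := tau_lin 1 y z; rewrite !scale1r.
have tauZ c y : tau (c *: y) = c *: tau y.
  by have := tau_lin c y 0; rewrite tau0 !addr0.
pose same (y z : ext N) :=
  half_polar (M := ext N) y z = half_polar (M := ext M) (tau y) (tau z).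
have same_sym y z : same y z -> same z y.
  by rewrite /same [in X in _ -> X]half_polar_sym [X in _ -> _ = X]half_polar_sym.
have same0 z : same 0 z by rewrite /same tau0 !half_polar0l.
have sameL c y y' z : same y z -> same y' z -> same (c *: y + y') z.
  by rewrite /same tauD tauZ !half_polar_lin // => -> ->.
have sameD y y' z : same y z -> same y' z -> same (y + y') z.
  by move=> yz yz'; rewrite -[y]scale1r; exact: sameL.
suff all_same : forall y z, same y z by exact: all_same.
apply: (@tensor_ind _ _ rho N (fun y : ext N => forall z, same y z))
  => [//|y y' ih ih' z|b u z].
  by apply: sameD.
apply: (same_sym); move: z.
apply: (@tensor_ind _ _ rho N (fun z : ext N => same z _))
  => [//|z z' ih ih'|b' v].
  exact: sameD.
have pureE c w : tpure rho c w = c *: tpure rho 1 w + 0 :> ext N.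
  by rewrite addr0 tpureZ mulr1.
rewrite pureE; apply: (sameL) => //; apply: (same_sym).
rewrite pureE; apply: sameL => //.
rewrite /same !tau_pure !scale1r !half_polar_extend //.
by rewrite (embeds_half_polar sq).
Qed.

End BaseChange.

(** * The embedding theorem *)

Section LatticeEmbedding.
Variables (R : idomainType) (t : R).
Hypotheses (R_complete : complete_dvr R) (tP : uniformizer t).
Hypothesis unit2 : (2 : R) \is a GRing.unit.
Variables (F : fieldType) (iota : {rmorphism R -> F}).
Hypothesis iota_inj : injective iota.
Hypothesis iota_frac : forall x, exists a b, b != 0 /\ x = iota a / iota b.
Variable E : fieldExtType F.
Hypothesis E_odd : odd (\dim {:E}).

Local Notation iotaE := [the {rmorphism R -> E} of in_alg E \o iota].
Local Notation SF := [the subringClosed F of integral_pred iota].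
Local Notation SE := [the subringClosed E of integral_pred iotaE].
Local Notation rho := (closure_map iotaE).
Local Notation j := (closure_val iotaE).
Local Notation ext := (extend_lattice [the {rmorphism F -> E} of in_alg E] rho j).

Let two_F : 2 != 0 :> F.
Proof.
rewrite -(rmorph_nat iota) -(rmorph0 iota) (inj_eq iota_inj).
by apply: contraTneq unit2 => ->; rewrite unitr0.
Qed.

(** In orthogonal bases [f] of [N] and [e] of [M], the image of [1 ⊗ f p] under
    [sigma] becomes the vector [z p] of [E]-coordinates to which [descent]
    applies. *)
Lemma embeds_descent (N M : quadratic_module iota) :
    quadratic_lattice N -> quadratic_lattice M ->
  embeds (ext N) (ext M) -> embeds N M.
Proof.
move=> NL ML [sigma sq].
have [_ _ NQ _] := NL; have [_ _ MQ _] := ML.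
have two_E : 2 != 0 :> E by rewrite -(rmorph_nat (in_alg E)) fmorph_eq0.
have half : (2 : F)^-1 \in SF.
  by rewrite -(rmorph_nat iota) -rmorphV // integral_mem.
have tS : iota t \in SF by exact: integral_mem.
have tN := frac_inv_nonunit tP iota_inj.
have S_val := frac_valuation R_complete tP iota_inj iota_frac.
have sqrtF := frac_inv_sqrt R_complete tP iota_inj iota_frac unit2.
have sqrtE := ext_inv_sqrt R_complete tP iota_inj iota_frac (E := E) unit2.
have SFP x : reflect (exists r, x = iota r) (x \in SF).
  apply: (iffP idP) => [|[r ->]]; last exact: integral_mem.
  exact: (frac_integral R_complete tP iota_inj iota_frac).
have [n [f [coN [coN_E coN_lin f_ortho f0 f_chain]]]] :=
  lattice_basis iota_inj tS tN half two_F S_val SFP NL.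
have [m [e [coM [coM_E coM_lin e_ortho e0 _]]]] :=
  lattice_basis iota_inj tS tN half two_F S_val SFP ML.
pose a k := half_polar (e k) (e k).
pose b p := if @insub _ _ 'I_n p is Some i then half_polar (f i) (f i) else 0.
have bE (i : 'I_n) : b i = half_polar (f i) (f i) by rewrite /b valK.
have square r : j (rho r) = in_alg E (iota r) by [].
have ex_coord p : exists s : 'I_m -> integral_closure iotaE,
   forall i : 'I_n, val i = p ->
     sigma (tpure rho 1 (f i)) = \sum_k s k *: tpure rho 1 (e k).
  case: (insubP 'I_n p) => [i _ ip|pn].
    have [s sE] := tensor_basis (rho := rho) coM_E (sigma (tpure rho 1 (f i))).
    by exists s => i' i'p; have -> : i' = i by apply: val_inj; rewrite ip.
  by exists (fun=> 0) => i ip; rewrite -ip ltn_ord in pn.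
pose s p := sval (cid (ex_coord p)).
have sE (i : 'I_n) :
    sigma (tpure rho 1 (f i)) = \sum_k s i k *: tpure rho 1 (e k).
  by rewrite /s; case: cid => s' /= ->.
pose z p : 'rV[E]_m := \row_k val (s p k).
have MQ' := extend_lattice_quadratic square MQ.
have z_ortho : ortho_system (dot (in_alg E \o a)) (in_alg E \o b) n z.
  move=> p q lt_pn lt_qn.
  pose fp := f (Ordinal lt_pn); pose fq := f (Ordinal lt_qn).
  have sig := embeds_half_polar sq (tpure rho 1 fp) (tpure rho 1 fq).
  rewrite half_polar_extend // !sE (half_polar_suml MQ') in sig.
  transitivity (in_alg E (half_polar fp fq)); last first.
    rewrite /fp /fq.
    have [pq|pq] := eqVneq p q.
      have -> : Ordinal lt_qn = Ordinal lt_pn by apply: val_inj; rewrite /= pq.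
      by rewrite -bE.
    by rewrite f_ortho ?rmorph0.
  rewrite -[RHS]sig; apply: eq_bigr => k _.
  rewrite (half_polar_sumr MQ') (bigD1 k) //= big1 => [|l lk].
    by rewrite half_polar_extend // !mxE addr0 /=; ring.
  by rewrite half_polar_extend // e_ortho 1?eq_sym // rmorph0 mulr0.
have [y [yS y_ortho]] : exists y : nat -> 'rV[F]_m,
    (forall p k, (p < n)%N -> y p 0 k \in SF) /\ ortho_system (dot a) b n y.
  apply: (@descent F SF (iota t) tS tN half two_F S_val sqrtF E SE E_odd _ sqrtE
    m n a b z) => //.
  - by move=> x xS; exact: (frac_ext_integral R_complete tP iota_inj iota_frac).
  - by move=> p lt_pn; rewrite (bE (Ordinal lt_pn)).
  - move=> p q le_pq lt_qn; have lt_pn := leq_ltn_trans le_pq lt_qn.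
    rewrite (bE (Ordinal lt_pn)) (bE (Ordinal lt_qn)); exact: f_chain.
  - by move=> p k _; rewrite mxE; exact: valP.
have ex_X (p : 'I_n) k : exists r, y p 0 k = iota r by apply/SFP; exact: yS.
pose X p k := sval (cid (ex_X p k)).
have XE p k : iota (X p k) = y p 0 k by rewrite /X; case: cid.
apply: (embeds_from_basis two_F NQ MQ (u := fun p => \sum_k X p k *: e k)
  coN_E coN_lin).
move=> p q; transitivity (dot a (y p) (y q)).
  rewrite (half_polar_suml MQ); apply: eq_bigr => k _.
  rewrite (half_polar_sumr MQ) (bigD1 k) //= big1 => [|l lk].
    by rewrite !XE addr0 /a; ring.
  by rewrite e_ortho 1?eq_sym // mulr0.
rewrite y_ortho //; have [->|pq] := eqVneq p q; first by rewrite eqxx bE.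
by rewrite val_eqE (negPf pq) f_ortho.
Qed.

Lemma embeds_iff_base_change (N M : quadratic_module iota) :
    quadratic_lattice N -> quadratic_lattice M ->
  embeds N M <-> embeds (ext N) (ext M).
Proof.
move=> NL ML; split; last exact: embeds_descent.
have two_E : 2 != 0 :> E by rewrite -(rmorph_nat (in_alg E)) fmorph_eq0.
have [_ _ NQ _] := NL; have [_ _ MQ _] := ML.
exact: embeds_base_change.
Qed.

End LatticeEmbedding.

Theorem theorem2p2 (R : idomainType) (hR : complete_dvr R)
    (h2 : (2%:R : R) \is a GRing.unit)
    (E : fieldExtType {fraction R}) (hE : odd (\dim {:E}))
    (M N : quadratic_module (frac_map R))
    (hM : quadratic_lattice M) (hN : quadratic_lattice N) :
  embeds N M <-> embeds (base_change E N) (base_change E M).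
Proof.
have [[pid [P [Pprime _]]] _] := hR.
have [t tP] : exists t : R, uniformizer t.
  have [Pideal _ _] := Pprime; have [t Pt] := pid P Pideal.
  by exists t, P.
exact: (embeds_iff_base_change hR tP h2 (@frac_map_inj R) (@frac_ratio R) hE hN hM).
Qed.
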